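(* Consider any aggregation rule $\mathrm{Aggr}(\cdot)$ of the form $$\widehat g_{\mathrm{Aggr}}=\frac1N\sum_{i=1}^N F_{\mathrm{Aggr}}[g_{\widehat{\mathcal D}_T},g_{\mathcal D_{S_i}}],$$ i.e., the aggregation rule is defined by a mapping $F_{\mathrm{Aggr}}:L^\pi\times L^\pi\to L^\pi$. Suppose that $F_{\mathrm{Aggr}}$ is affine with respect to its first argument (the target gradient function), that $F_{\mathrm{Aggr}}[g,g]=g$ for all $g\in L^\pi$, and that the linear mapping associated with $F_{\mathrm{Aggr}}$ (the linear part of the affine map $F_{\mathrm{Aggr}}[\cdot,g']$) has its eigenvalues bounded in $[\lambda_{\min},\lambda_{\max}]$. Then for any source and target distributions $\{\mathcal D_{S_i}\}_{i=1}^N$, $\mathcal D_T$ and target dataset $\widehat{\mathcal D}_T$ of size $n$, $$\Delta^2_{\mathrm{Aggr}}\le\frac1N\sum_{i=1}^N\Delta^2_{\mathrm{Aggr},\mathcal D_{S_i}},$$ where $$\Delta^2_{\mathrm{Aggr},\mathcal D_{S_i}}\le\max\{\lambda_{\max}^2,\lambda_{\min}^2\}\cdot\frac{\sigma_\pi^2(z)}{n}+\max\{(1-\lambda_{\max})^2,(1-\lambda_{\min})^2\}\cdot d_\pi(\mathcal D_{S_i},\mathcal D_T)^2.$$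
   Context: Setting. $\mathcal Z$ is a ground set of data points, $\Theta=\mathbb{R}^m$ is the parameter space with Euclidean norm $\|\cdot\|$, and $\ell:\Theta\times\mathcal Z\to\mathbb{R}_+$ is a loss, differentiable in $\theta$; $\nabla$ denotes the gradient in $\theta$. For a distribution $\mathcal D$ on $\mathcal Z$, $\ell_{\mathcal D}(\theta):=\mathbb{E}_{z\sim\mathcal D}\,\ell(\theta,z)$ and $g_{\mathcal D}(\theta):=\nabla\ell_{\mathcal D}(\theta)$; for a finite dataset $\widehat{\mathcal D}$, $\ell_{\widehat{\mathcal D}}(\theta):=\frac{1}{|\widehat{\mathcal D}|}\sum_{z\in\widehat{\mathcal D}}\ell(\theta,z)$ and $g_{\widehat{\mathcal D}}:=\nabla\ell_{\widehat{\mathcal D}}$. Given a probability measure $\pi$ on $\Theta$, $\langle g,g'\rangle_\pi:=\mathbb{E}_{\theta\sim\pi}\langle g(\theta),g'(\theta)\rangle$, $\|g\|_\pi:=\sqrt{\mathbb{E}_{\theta\sim\pi}\|g(\theta)\|^2}$, and $L^\pi:=\{g:\Theta\to\Theta\mid\|g\|_\pi<\infty\}$. All gradient functions involved are taken to lie in $L^\pi$. There are $N$ source domains $\mathcal D_{S_1},\dots,\mathcal D_{S_N}$, treated as fixed, and a target domain $\mathcal D_T$. The target dataset $\widehat{\mathcal D}_T=\{z_1,\dots,z_n\}$ consists of $n$ i.i.d. samples from $\mathcal D_T$; in particular $\mathbb{E}_{\widehat{\mathcal D}_T}[g_{\widehat{\mathcal D}_T}]=g_{\mathcal D_T}$. Quantities: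 - Delta error: $\Delta^2_{\mathrm{Aggr}}:=\mathbb{E}_{\widehat{\mathcal D}_T}\|g_{\mathcal D_T}-\widehat g_{\mathrm{Aggr}}\|_\pi^2$. - Per-source Delta error: $\Delta^2_{\mathrm{Aggr},\mathcal D_{S_i}}:=\mathbb{E}_{\widehat{\mathcal D}_T}\|g_{\mathcal D_T}-F_{\mathrm{Aggr}}[g_{\widehat{\mathcal D}_T},g_{\mathcal D_{S_i}}]\|_\pi^2$. - Source–target distance: $d_\pi(\mathcal D_S,\mathcal D_T):=\|g_{\mathcal D_T}-g_{\mathcal D_S}\|_\pi$. - Single-sample variance: $\sigma_\pi^2(z):=\mathbb{E}_{z\sim\mathcal D_T}\|g_{\mathcal D_T}-\nabla\ell(\cdot,z)\|_\pi^2$. The linear mapping associated with the affine map $F_{\mathrm{Aggr}}[\cdot,g']$ is the linear map $G:L^\pi\to L^\pi$ with $F_{\mathrm{Aggr}}[g_1,g']-F_{\mathrm{Aggr}}[g_2,g']=G[g_1-g_2]$ for all $g_1,g_2\in L^\pi$.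
   Formalization: The linear mapping associated with F_Aggr is additionally assumed self-adjoint for the π-inner product, and its spectrum (not only its eigenvalues) is assumed to lie in [λ_min, λ_max]; the claim fails without these. *)

(* Defs.v *)
From HB Require Import structures.
From mathcomp Require Import all_boot all_order all_algebra.
From mathcomp Require Import all_classical all_reals all_analysis.

Set Implicit Arguments.
Unset Strict Implicit.
Unset Printing Implicit Defensive.

Import Order.TTheory GRing.Theory Num.Theory.
Import numFieldNormedType.Exports.

Local Open Scope classical_set_scope.
Local Open Scope ring_scope.

(* R^m with its Borel sigma-algebra.  The library norm on 'rV[R]_m is the sup
   norm (same topology), so the Euclidean structure is given separately. *)
Definition borelRV (R : realType) (m : nat) :=
  g_sigma_algebraType (@open 'rV[R]_m).

Definition dotv (R : realType) (m : nat) (u v : 'rV[R]_m) : R :=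
  \sum_(j < m) u 0 j * v 0 j.

Definition enorm (R : realType) (m : nat) (u : 'rV[R]_m) : R :=
  Num.sqrt (dotv u u).

Definition grad (R : realType) (m : nat) (f : 'rV[R]_m -> R)
  (theta : 'rV[R]_m) : 'rV[R]_m :=
  \row_(j < m) 'D_(delta_mx 0 j) f theta.

Section Lpi.
Variables (R : realType) (m : nat) (pi : probability (borelRV R m) R).
Implicit Types (g h : 'rV[R]_m -> 'rV[R]_m)
  (G A : ('rV[R]_m -> 'rV[R]_m) -> ('rV[R]_m -> 'rV[R]_m)).

Definition pi_dot g h : \bar R := (\int[pi]_t (dotv (g t) (h t))%:E)%E.

Definition pi_norm g : \bar R := sqrte (\int[pi]_t ((enorm (g t)) ^+ 2)%:E)%E.

Definition Lpi : set ('rV[R]_m -> 'rV[R]_m) :=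
  [set g : 'rV[R]_m -> 'rV[R]_m |
    (forall j, measurable_fun [set: borelRV R m] (fun t => g t 0 j))
    /\ (pi_norm g < +oo)%E].

(* Elements of L^pi are represented by functions; equalities between them are
   required only pi-almost everywhere. *)
Definition linear_Lpi G :=
  (forall g, Lpi g -> Lpi (G g)) /\
  (forall (a : R) g h, Lpi g -> Lpi h ->
     G (a *: g + h) = a *: G g + G h %[ae pi]).

Definition linear_part A G :=
  linear_Lpi G /\
  (forall g h, Lpi g -> Lpi h -> A g - A h = G (g - h) %[ae pi]).

Definition affine_Lpi A :=
  (forall g, Lpi g -> Lpi (A g)) /\ (exists G, linear_part A G).

(* A bound on the eigenvalues of G controls G g and g - G g in norm only in the
   presence of such a symmetry: the nilpotent map (x, y) |-> (c * y, 0) has 0 as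
   its only eigenvalue for every c. *)
Definition self_adjoint G :=
  forall g h, Lpi g -> Lpi h -> pi_dot (G g) h = pi_dot g (G h).

Definition bounded_Lpi G :=
  exists c : R, forall g, Lpi g -> (pi_norm (G g) <= c%:E * pi_norm g)%E.

(* G - lam has a bounded linear two-sided inverse on L^pi. *)
Definition resolvent_set G : set R :=
  [set lam | exists B,
     [/\ linear_Lpi B, bounded_Lpi B,
         forall g, Lpi g -> G (B g) - lam *: B g = g %[ae pi]
       & forall g, Lpi g -> B (G g - lam *: g) = g %[ae pi]]].

(* The eigenvalues of G, in the sense appropriate to the possibly
   infinite-dimensional L^pi.  Every lam with a nonzero g in L^pi such that
   G g = lam *: g is in the spectrum, and there is nothing else in it when L^pi
   is finite-dimensional modulo pi-a.e. equality. Real scalars lose nothing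
   for self-adjoint maps, whose complex spectrum is real. *)
Definition spectrum G : set R := ~` resolvent_set G.

End Lpi.

Arguments pi_norm {R m} pi g%_ring_scope.

Section loss.
Variables (R : realType) (m : nat) (d : measure_display)
  (Z : measurableType d) (l : 'rV[R]_m -> Z -> R).

Definition risk (D : probability Z R) (theta : 'rV[R]_m) : R :=
  fine (\int[D]_z (l theta z)%:E)%E.

Definition emp_risk (n : nat) (zs : 'I_n -> Z) (theta : 'rV[R]_m) : R :=
  n%:R^-1 * \sum_(i < n) l theta (zs i).

(* l_D and its gradient g_D are well defined, and g_D lies in L^pi. *)
Definition admissible (pi : probability (borelRV R m) R) (D : probability Z R) :=
  [/\ forall theta, D.-integrable setT (fun z => (l theta z)%:E),
      forall theta, differentiable (risk D) theta
    & Lpi pi (grad (risk D))].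

Definition pi_dist (pi : probability (borelRV R m) R)
  (DS DT : probability Z R) : \bar R :=
  pi_norm pi (grad (risk DT) - grad (risk DS)).

Definition sigma2 (pi : probability (borelRV R m) R) (DT : probability Z R) :
  \bar R :=
  (\int[DT]_z (pi_norm pi (grad (risk DT) - grad (fun t => l t z))) ^+ 2)%E.

End loss.

Definition mutually_independent (R : realType) (d d' : measure_display)
    (Omega : measurableType d) (Z : measurableType d')
    (P : probability Omega R) (n : nat) (zs : 'I_n -> {RV P >-> Z}) :=
  forall (J : {set 'I_n}) (B : 'I_n -> set Z), (forall i, measurable (B i)) ->
    P (\bigcap_(i in [set` J]) (zs i @^-1` B i)) =
    (\prod_(i in J) P (zs i @^-1` B i))%E.

Definition iid (R : realType) (d d' : measure_display)
    (Omega : measurableType d) (Z : measurableType d')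
    (P : probability Omega R) (D : probability Z R)
    (n : nat) (zs : 'I_n -> {RV P >-> Z}) :=
  mutually_independent zs /\
  (forall i B, measurable B -> distribution P (zs i) B = D B).

Section errors.
Variables (R : realType) (m : nat) (d d' : measure_display)
  (Omega : measurableType d) (Z : measurableType d')
  (pi : probability (borelRV R m) R) (l : 'rV[R]_m -> Z -> R)
  (F : ('rV[R]_m -> 'rV[R]_m) -> ('rV[R]_m -> 'rV[R]_m) ->
       ('rV[R]_m -> 'rV[R]_m))
  (P : probability Omega R) (n : nat) (zs : 'I_n -> {RV P >-> Z})
  (DT : probability Z R).

Definition g_hat (w : Omega) : 'rV[R]_m -> 'rV[R]_m :=
  grad (emp_risk l (fun i => zs i w)).

Definition aggr (N : nat) (DS : 'I_N -> probability Z R) (w : Omega) :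
  'rV[R]_m -> 'rV[R]_m :=
  N%:R^-1 *: \sum_(i < N) F (g_hat w) (grad (risk l (DS i))).

Definition delta2_aggr (N : nat) (DS : 'I_N -> probability Z R) : \bar R :=
  (\int[P]_w (pi_norm pi (grad (risk l DT) - aggr DS w)) ^+ 2)%E.

Definition delta2_source (DS : probability Z R) : \bar R :=
  (\int[P]_w (pi_norm pi (grad (risk l DT)
                          - F (g_hat w) (grad (risk l DS)))) ^+ 2)%E.

End errors.

(* Main.v *)
Require Import Defs.
From HB Require Import structures.
From mathcomp Require Import all_boot all_order all_algebra.
From mathcomp Require Import all_classical all_reals all_analysis.
From mathcomp Require Import measurable_realfun ring lra.

Import Order.TTheory GRing.Theory Num.Theory.
Import numFieldNormedType.Exports HBNNSimple.

Local Open Scope classical_set_scope.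
Local Open Scope ring_scope.

(* Let T be the linear part of F[., g_S], X = g_hat - g_T the centred empirical
   gradient and u = g_T - g_S. As F[g_S, g_S] = g_S, the error of one source is
   (1 - T) u - T X.  A symmetric map whose real spectrum lies in [lmin, lmax]
   satisfies lmin |v|^2 <= <T v, v> <= lmax |v|^2, which bounds T and 1 - T in
   norm.  Expanding |(1 - T) u - T X|^2, the cross term has mean zero, and
   independence gives E |X|^2 = sigma^2 / n.  Averaging over the sources is
   Jensen's inequality. *)

(** * Symmetric operators on a semi-inner product space *)

(** Two obstacles shape the argument. The spectral hypothesis concerns real scalars only, on a
    possibly infinite-dimensional space where maps are determined up to negligible sets, so no
    eigenbasis is used. The passage from spectrum to numerical range goes through resolvents: the
    distance from lam to the spectrum bounds |T v - lam v| from below, and large |lam| isolates <T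
    v, v>. Operator identities are tested against arbitrary elements, which requires neither
    completeness nor definiteness of the product. The other obstacle is measurability and
    integrability over the samples. As [T] is abstract, nothing makes T X jointly measurable in
    theta and the sample point, and the variance may be infinite. Strong measurability of X makes
    the squared error a measurable function of the sample point. For its mean, |T X|^2 is first
    replaced by L^2 |X|^2, where L = max(|lmax|, |lmin|); up to a constant this leaves |L X - b|^2
    with b = T a / L and a = (1 - T) u, an explicit nonnegative kernel. Its cross term vanishes at
    each fixed theta and coordinate, where unbiasedness is a statement about scalars. *)

Section symmetric_operators.
Variables (R : realType) (V : lmodType R) (dot : V -> V -> R).
Hypothesis dotC : forall u v, dot u v = dot v u.
Hypothesis dot_lin : forall a u v w, dot (a *: u + v) w = a * dot u w + dot v w.
Hypothesis dot_ge0 : forall u, 0 <= dot u u.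

Local Notation q u := (dot u u).

Lemma dotD u v w : dot (u + v) w = dot u w + dot v w.
Proof. by have := dot_lin 1 u v w; rewrite scale1r mul1r. Qed.

Lemma dot0l w : dot 0 w = 0.
Proof. by have := dotD 0 0 w; rewrite addr0; lra. Qed.

Lemma dotZ a u w : dot (a *: u) w = a * dot u w.
Proof. by have := dot_lin a u 0 w; rewrite addr0 dot0l addr0. Qed.

Lemma dotN u w : dot (- u) w = - dot u w.
Proof. by rewrite -scaleN1r dotZ mulN1r. Qed.

Lemma dotDr u v w : dot u (v + w) = dot u v + dot u w.
Proof. by rewrite dotC dotD !(dotC u). Qed.

Lemma dotZr a u w : dot u (a *: w) = a * dot u w.
Proof. by rewrite dotC dotZ (dotC u). Qed.

Lemma dotNr u w : dot u (- w) = - dot u w.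
Proof. by rewrite dotC dotN (dotC u). Qed.

Definition dotE := (dotD, dotDr, dotN, dotNr, dotZ, dotZr).

(** This replaces rewriting with equalities of elements: functions equal almost everywhere have the
    same products, and only their norms matter in the end. *)
Lemma q_weak_eq x y : (forall z, dot x z = dot y z) -> q x = q y.
Proof. by move=> xy; rewrite xy dotC xy. Qed.

Lemma q_add_le x y : q (x + y) <= 2 * q x + 2 * q y.
Proof. by have := dot_ge0 (x - y); rewrite !dotE (dotC y x); lra. Qed.

(** The spread about the mean s is nonnegative: the sum of q (x i - s) equals the sum of q (x i)
    minus N q s. *)
Lemma q_mean_le (N : nat) (x : 'I_N -> V) : (0 < N)%N ->
  q (N%:R^-1 *: \sum_i x i) <= N%:R^-1 * \sum_i q (x i).
Proof.
move=> N0; suff : forall s, \sum_i x i = N%:R *: s ->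
    q s <= N%:R^-1 * \sum_i q (x i).
  by apply; rewrite scalerA divff ?scale1r// pnatr_eq0 -lt0n.
move=> s NE.
have dot_sum y : dot (\sum_i x i) y = \sum_i dot (x i) y.
  apply: (big_morph (fun u => dot u y)); last exact: dot0l.
  by move=> ? ?; rewrite dotD.
have : 0 <= \sum_i q (x i - s) by apply: sumr_ge0 => i _; exact: dot_ge0.
under eq_bigr => i _ do rewrite !dotE (dotC s) opprK.
rewrite !big_split/= sumr_const card_ord !sumrN -!dot_sum NE !dotE -mulr_natl.
have Np : 0 < N%:R :> R by rewrite ltr0n.
move=> h; rewrite ler_pdivlMl//; lra.
Qed.

Definition symmetric_op (G : V -> V) := forall u v, dot (G u) v = dot u (G v).

(* Operators on L^pi are determined up to pi-negligible sets only, so they are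
   compared through their products with every z. *)
Definition weak_resolvent (G : V -> V) (lam : R) := exists (B : V -> V) (c : R),
  [/\ forall y z, dot (G (B y) - lam *: B y) z = dot y z,
      forall y z, dot (B (G y - lam *: y)) z = dot y z &
      forall y, q (B y) <= c * q y].

Variable G : V -> V.
Hypothesis symG : symmetric_op G.

(** Symmetry moves G onto w, and the product is linear in its other argument. *)
Lemma symmetric_lin a u v w :
  dot (G (a *: u + v)) w = a * dot (G u) w + dot (G v) w.
Proof. by rewrite symG dot_lin -!symG. Qed.

Lemma weak_resolvent_below lam : weak_resolvent G lam ->
  exists2 c, 0 <= c & forall x, q x <= c * q (G x - lam *: x).
Proof.
move=> [B [c [_ BG Bc]]]; exists `|c| => // x.
rewrite -(q_weak_eq _ _ (BG x)); apply: le_trans (Bc _) _.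
by rewrite ler_wpM2r ?dot_ge0// ler_norm.
Qed.

(* The norm of the resolvent B at lam is attained in the spectrum: if it were
   r > 1/d, then r - B and r + B, hence r^2 - B^2, would be bounded below, while
   |(r^2 - B^2) y|^2 <= r^2 (r^2 |y|^2 - |B y|^2). *)
Lemma dist_spectrum lam (d : R) : 0 < d ->
  (forall mu, `|mu - lam| < d -> weak_resolvent G mu) ->
  forall x, d ^+ 2 * q x <= q (G x - lam *: x).
Proof.
move=> d0 hres x.
have [B [c0 [GB BG Bc]]] : weak_resolvent G lam.
  by apply: hres; rewrite subrr normr0.
(* The inverse of a symmetric map is symmetric: <B u, v> = <B u, (G - lam) B v> = <(G - lam) B u, B
   v> = <u, B v>. *)
have symB u v : dot (B u) v = dot u (B v).
  by rewrite dotC -GB -(GB u) !dotE symG !(dotC (B v)).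
have Blin a u v w : dot (B (a *: u + v)) w = a * dot (B u) w + dot (B v) w.
  by rewrite symB dot_lin -!symB.
(* The infimum r2 of S is the squared operator norm of B, and is itself one of the bounds in S. *)
pose S := [set c | 0 <= c /\ forall y, q (B y) <= c * q y].
have S_lb : has_inf S.
  split; last by exists 0 => c [].
  exists `|c0|; split=> // y; apply: le_trans (Bc y) _.
  by rewrite ler_wpM2r ?dot_ge0// ler_norm.
pose r2 := inf S.
have r2_ge0 : 0 <= r2 by apply: lb_le_inf => [|c []//]; case: S_lb.
have Br2 y : q (B y) <= r2 * q y.
  have := dot_ge0 y; rewrite le_eqVlt => /predU1P[qy0|qy0].
    by have := Bc y; rewrite -qy0 !mulr0.
  rewrite -ler_pdivrMr//; apply: lb_le_inf; first by case: S_lb.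
  by move=> c [_ cB]; rewrite ler_pdivrMr.
suff r2d : r2 <= (d ^+ 2)^-1.
  rewrite -(q_weak_eq _ _ (BG x)) -ler_pdivlMl ?exprn_gt0//.
  by apply: le_trans (Br2 _) _; rewrite ler_wpM2r ?dot_ge0.
rewrite leNgt; apply/negP => dr2.
have r2_gt0 : 0 < r2 by apply: le_lt_trans dr2; rewrite invr_ge0 exprn_ge0// ltW.
pose r := Num.sqrt r2.
have r0 : 0 < r by rewrite sqrtr_gt0.
have r2E : r2 = r ^+ 2 by rewrite sqr_sqrtr.
have rd : r^-1 < d.
  rewrite -ltf_pV2 ?posrE ?invr_gt0// invrK -(ltr_pXn2r (n:=2)) ?nnegrE ?invr_ge0 ?ltW//.
  by rewrite -r2E exprVn.
(* The point lam + s is closer to lam than d, and z - s B z is weakly (G - lam - s) B z. This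
   controls B z, and then z = (z - s B z) + s B z. *)
have below (s : R) : `|s| = r^-1 ->
    exists2 K, 0 < K & forall z, q z <= K * q (z - s *: B z).
  move=> sr; have /weak_resolvent_below[c c0' hc] : weak_resolvent G (lam + s).
    by apply: hres; rewrite addrC addKr sr.
  have hB z : q (B z) <= c * q (z - s *: B z).
    apply: le_trans (hc _) _; rewrite le_eqVlt; apply/orP; left; apply/eqP.
    congr (_ * _); apply: q_weak_eq => w.
    by have := GB z w; rewrite scalerDl !dotE => <-; lra.
  exists (2 + 2 * s ^+ 2 * c).
    by rewrite ltr_wpDr// mulr_ge0// mulr_ge0// sqr_ge0.
  move=> z; have := q_add_le (z - s *: B z) (s *: B z).
  rewrite subrK => /le_trans; apply.
  rewrite (dotZ s (B z)) (dotZr s (B z)).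
  have := ler_wpM2l (sqr_ge0 s) (hB z); lra.
have [|K1 K1_gt0 hK1] := below r^-1; first by rewrite gtr0_norm ?invr_gt0.
have [|K2 K2_gt0 hK2] := below (- r^-1); first by rewrite normrN gtr0_norm ?invr_gt0.
pose K := K1 * K2; have K_gt0 : 0 < K by rewrite mulr_gt0.
(* Apply [below] at both signs to factor 1 - B^2 / r2 as (1 - B / r)(1 + B / r). Since q (B (B y))
   <= r2 q (B y), expanding the square leaves at most q y - q (B y) / r2. *)
have step y : q (B y) <= (r2 - r2 / K) * q y.
  have h : q y <= K * (q y - r2^-1 * q (B y)).
    apply: le_trans (hK2 y) _; rewrite /K (mulrC K1) -mulrA ler_pM2l//.
    set z := y - _; apply: le_trans (hK1 z) _; rewrite ler_pM2l//.
    have -> : q (z - r^-1 *: B z) = q (y - r2^-1 *: B (B y)).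
      apply: q_weak_eq => w.
      have zE : z = r^-1 *: B y + y by rewrite /z scaleNr opprK addrC.
      have Bz : dot (B z) w = r^-1 * dot (B (B y)) w + dot (B y) w by rewrite zE Blin.
      rewrite (dotD z) (dotN (_ *: B z)) (dotZ _ (B z)) Bz zE r2E -exprVn !dotE.
      by ring.
    rewrite !dotE (dotC (B (B y))) -(symB y (B y)).
    have r2V : 0 < r2^-1 by rewrite invr_gt0.
    have := Br2 (B y); rewrite -ler_pdivrMl// => /(ler_wpM2l (ltW r2V)); lra.
  rewrite -(ler_pM2l (x := r2^-1)) ?invr_gt0// mulrA mulrBr mulrA mulVf ?gt_eqF// mul1r.
  move: h; rewrite -ler_pdivrMl//; lra.
(* Members of S are nonnegative, whereas r2 - r2 / K is negative when K < 1. *)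
have step0 : forall y, q (B y) <= Num.max 0 (r2 - r2 / K) * q y.
  move=> y; apply: le_trans (step y) _.
  by rewrite ler_wpM2r ?dot_ge0// le_max lexx orbT.
have : r2 <= Num.max 0 (r2 - r2 / K).
  by apply: ge_inf; [case: S_lb|split=> //; rewrite le_max lexx].
rewrite le_max leNgt r2_gt0/= lerBrDr gerDl leNgt divr_gt0//.
Qed.

Lemma dist_spectrumE lam x :
  q (G x - lam *: x) = q (G x) - 2 * lam * dot (G x) x + lam ^+ 2 * q x.
Proof. by rewrite !dotE (dotC x); ring. Qed.

(* Expand [dist_spectrum] at lam > lmax and let lam tend to +oo. *)
Lemma numerical_range_le lmax :
  (forall lam, lmax < lam -> weak_resolvent G lam) ->
  forall x, dot (G x) x <= lmax * q x.
Proof.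
move=> hres x; rewrite -subr_le0 leNgt; apply/negP.
set e := _ - _ => e0; pose C := q (G x) - lmax ^+ 2 * q x.
(* With d = lam - lmax the terms in lam^2 cancel and 2 lam e <= C remains, so any lam above C / (2
   e) is contradictory. *)
pose lam := Num.max (lmax + 1) (C / (2 * e) + 1).
have lamC : C / (2 * e) < lam by rewrite lt_max ltrDl ltr01 orbT.
have ll : lmax < lam by rewrite lt_max ltrDl ltr01.
have : (lam - lmax) ^+ 2 * q x <= q (G x - lam *: x).
  apply: dist_spectrum => [|mu]; first by rewrite subr_gt0.
  by rewrite ltr_norml => /andP[h _]; apply: hres; lra.
rewrite dist_spectrumE; move: lamC; rewrite ltr_pdivrMr ?mulr_gt0//.
by rewrite /C /e; lra.
Qed.

(** The mirror image of the upper bound: the spectrum is viewed from the point - lam, with lam large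
    and positive. *)
Lemma numerical_range_ge lmin :
  (forall lam, lam < lmin -> weak_resolvent G lam) ->
  forall x, lmin * q x <= dot (G x) x.
Proof.
move=> hres x; rewrite -subr_le0 leNgt; apply/negP.
set e := _ - _ => e0; pose C := q (G x) - lmin ^+ 2 * q x.
pose lam := Num.max (1 - lmin) (C / (2 * e) + 1).
have lamC : C / (2 * e) < lam by rewrite lt_max ltrDl ltr01 orbT.
have ll : - lam < lmin by rewrite ltrNl lt_max ltrBrDl subrr ltr01.
have : (lmin - - lam) ^+ 2 * q x <= q (G x - (- lam) *: x).
  apply: dist_spectrum => [|mu]; first by rewrite subr_gt0.
  by rewrite ltr_norml => /andP[_ h]; apply: hres; lra.
rewrite dist_spectrumE; move: lamC; rewrite ltr_pdivrMr ?mulr_gt0//.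
by rewrite /C /e; lra.
Qed.

(** Polarization: subtracting the forms at x + s G x and x - s G x leaves 4 s q (G x), while the
    parallelogram law bounds the difference by 2 L (q x + s^2 q (G x)). The best choice is s = 1 /
    L; for L = 0 any positive s will do. *)
Lemma symmetric_norm_le L : 0 <= L ->
  (forall x, `|dot (G x) x| <= L * q x) ->
  forall x, q (G x) <= L ^+ 2 * q x.
Proof.
move=> L0 hL x.
have polar s : 2 * s * q (G x) <= L * (q x + s ^+ 2 * q (G x)).
  have := hL (x + s *: G x); have := hL (x + (- s) *: G x).
  rewrite !(addrC x) !ler_norml => /andP[h1 _] /andP[_ h2].
  move: h1 h2; rewrite !dotDr !dotZr !symmetric_lin !dotE.
  rewrite (symG (G x) x) (dotC x (G x)); lra.
have [L_gt0|] := ltP 0 L.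
  have := polar L^-1; rewrite -(ler_pM2l L_gt0).
  have -> : L * (2 / L * q (G x)) = 2 * q (G x) by field; lra.
  have -> : L * (L * (q x + L^-1 ^+ 2 * q (G x))) = L ^+ 2 * q x + q (G x).
    by field; lra.
  lra.
move=> Ln; have {L0 Ln hL}L0 : L = 0 by apply/eqP; rewrite eq_le Ln.
by have := polar 1; rewrite L0 expr0n/=; lra.
Qed.

End symmetric_operators.

(** * The space L^pi *)

Section dotv_theory.
Variables (R : realType) (m : nat).
Implicit Types u v w : 'rV[R]_m.

Lemma dotvC u v : dotv u v = dotv v u.
Proof. by apply: eq_bigr => j _; rewrite mulrC. Qed.

Lemma dotv_lin a u v w : dotv (a *: u + v) w = a * dotv u w + dotv v w.
Proof.
rewrite /dotv mulr_sumr -big_split/=; apply: eq_bigr => j _.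
by rewrite !mxE mulrDl mulrA.
Qed.

Lemma dotv_ge0 u : 0 <= dotv u u.
Proof. by apply: sumr_ge0 => j _; rewrite -expr2 sqr_ge0. Qed.

Lemma enorm_sqr u : enorm u ^+ 2 = dotv u u.
Proof. by rewrite /enorm sqr_sqrtr ?dotv_ge0. Qed.

Lemma normr_dotv_le u v : `|dotv u v| <= dotv u u + dotv v v.
Proof.
have h x y : `|x * y| <= x * x + y * y :> R.
  rewrite -!expr2 ler_norml.
  have := sqr_ge0 (x - y); have := sqr_ge0 (x + y); have := sqr_ge0 x.
  by have := sqr_ge0 y; lra.
rewrite /dotv -big_split/=; apply: le_trans (ler_norm_sum _ _ _) _.
by apply: ler_sum => j _; exact: h.
Qed.

End dotv_theory.

Section Lpi_theory.
Variables (R : realType) (m : nat) (pi : probability (borelRV R m) R).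
Implicit Types g h k : 'rV[R]_m -> 'rV[R]_m.

Lemma Lpi_measurable g h : Lpi pi g -> Lpi pi h ->
  measurable_fun [set: borelRV R m] (fun t => dotv (g t) (h t)).
Proof.
move=> [mg _] [mh _]; apply: measurable_sum => j.
by apply: measurable_funM; [exact: mg|exact: mh].
Qed.

Lemma pi_norm_sqr g : (pi_norm pi g ^+ 2 = pi_dot pi g g)%E.
Proof.
rewrite /pi_norm sqr_sqrte; last first.
  by apply: integral_ge0 => t _; rewrite lee_fin sqr_ge0.
by apply: eq_integral => t _; rewrite enorm_sqr.
Qed.

Lemma pi_dot_ge0 g : (0 <= pi_dot pi g g)%E.
Proof. by apply: integral_ge0 => t _; rewrite lee_fin dotv_ge0. Qed.

Lemma LpiP g : Lpi pi g <->
  (forall j, measurable_fun [set: borelRV R m] (fun t => g t 0 j)) /\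
  pi.-integrable [set: borelRV R m] (fun t => (dotv (g t) (g t))%:E).
Proof.
have sqr_fin : (pi_norm pi g < +oo)%E <-> (pi_dot pi g g < +oo)%E.
  rewrite -!ge0_fin_numE ?pi_dot_ge0 ?sqrte_ge0//.
  rewrite /pi_norm sqrte_fin_num; last first.
    by apply: integral_ge0 => t _; rewrite lee_fin sqr_ge0.
  rewrite (_ : pi_dot _ _ _ = \int[pi]_t ((enorm (g t)) ^+ 2)%:E)%E//.
  by apply: eq_integral => t _; rewrite enorm_sqr.
split=> -[mg h]; split=> //.
  apply/integrableP; split.
    apply/measurable_EFinP/measurable_sum => j.
    by apply: measurable_funM; exact: mg.
  under eq_integral => t _ do rewrite gee0_abs ?lee_fin ?dotv_ge0//.
  exact/sqr_fin.
apply/sqr_fin; move/integrableP: h => [_]; apply: le_lt_trans.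
rewrite le_eqVlt; apply/orP; left; apply/eqP.
by apply: eq_integral => t _; rewrite gee0_abs ?lee_fin ?dotv_ge0.
Qed.

Lemma Lpi_integrable g h : Lpi pi g -> Lpi pi h ->
  pi.-integrable [set: borelRV R m] (fun t => (dotv (g t) (h t))%:E).
Proof.
move=> Lg Lh; have [_ ig] := (LpiP g).1 Lg; have [_ ih] := (LpiP h).1 Lh.
apply: (le_integrable _ _ _ (integrableD _ ig ih)) => //.
  by apply/measurable_EFinP; exact: (Lpi_measurable g h).
move=> t _; rewrite /= lee_fin [leRHS]ger0_norm ?addr_ge0 ?dotv_ge0//.
exact: normr_dotv_le.
Qed.

Lemma pi_dot_fin g h : Lpi pi g -> Lpi pi h ->
  pi_dot pi g h = (fine (pi_dot pi g h))%:E.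
Proof.
by move=> Lg Lh; rewrite fineK//; apply: integrable_fin_num => //; exact: Lpi_integrable.
Qed.

Definition Lpi_pred : {pred 'rV[R]_m -> 'rV[R]_m} := mem (Lpi pi).

Lemma Lpi_submod_closed : submod_closed Lpi_pred.
Proof.
split=> [|a g h].
  apply/mem_set/LpiP; split=> [j|].
    by under eq_fun do rewrite mxE; exact: measurable_cst.
  apply: eq_integrable (integrable0 _ _) => // t _; congr EFin.
  by rewrite /dotv big1// => j _; rewrite !mxE mul0r.
move=> /set_mem Lg /set_mem Lh; apply/mem_set/LpiP.
have [mg ig] := (LpiP g).1 Lg; have [mh ih] := (LpiP h).1 Lh.
have mgh j : measurable_fun [set: borelRV R m] (fun t => (a *: g + h) t 0 j).
  have -> : (fun t => (a *: g + h) t 0 j) = (fun t => a * g t 0 j + h t 0 j).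
    by apply/funext => t; rewrite !mxE.
  by apply: measurable_funD => //; apply: measurable_funM => //; exact: measurable_cst.
split=> //.
have igg := integrableZl measurableT (2 * a ^+ 2) ig.
have ihh := integrableZl measurableT 2 ih.
apply: (le_integrable _ _ _ (integrableD _ igg ihh)) => //.
  apply/measurable_EFinP/measurable_sum => j.
  by apply: measurable_funM; exact: mgh.
move=> t _; rewrite /= lee_fin.
rewrite [leLHS]ger0_norm ?dotv_ge0//.
rewrite [leRHS]ger0_norm; last first.
  by rewrite addr_ge0// mulr_ge0 ?dotv_ge0// mulr_ge0// sqr_ge0.
rewrite !mulr_sumr -big_split/=; apply: ler_sum => j _.
by rewrite !mxE; have := sqr_ge0 (a * g t 0 j - h t 0 j); lra.
Qed.

Lemma Lpi0 : Lpi pi 0.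
Proof. by apply: set_mem; case: Lpi_submod_closed. Qed.

Lemma Lpi_lin a g h : Lpi pi g -> Lpi pi h -> Lpi pi (a *: g + h).
Proof.
move=> Lg Lh; apply: set_mem; case: Lpi_submod_closed => _; apply; exact: mem_set.
Qed.

Lemma LpiZ a g : Lpi pi g -> Lpi pi (a *: g).
Proof. by move=> Lg; rewrite -[_ *: _]addr0; apply: Lpi_lin => //; exact: Lpi0. Qed.

Lemma Lpi_sum (I : Type) (s : seq I) (g_ : I -> 'rV[R]_m -> 'rV[R]_m) :
  (forall i, Lpi pi (g_ i)) -> Lpi pi (\sum_(i <- s) g_ i).
Proof.
move=> Lg; elim/big_ind : _ => //; first exact: Lpi0.
by move=> g h Lg' Lh; rewrite -[g]scale1r; exact: Lpi_lin.
Qed.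

HB.instance Definition _ :=
  GRing.isSubmodClosed.Build R ('rV[R]_m -> 'rV[R]_m) Lpi_pred Lpi_submod_closed.

(** Elements are functions rather than classes modulo negligible sets, so evaluation at theta
    remains available for Fubini. The price is that [dotL] is only a semi-inner product. *)
Record LpiType := MkLpi { Lpi_fun :> 'rV[R]_m -> 'rV[R]_m ; _ : Lpi_fun \in Lpi_pred }.

HB.instance Definition _ := [isSub for Lpi_fun].
HB.instance Definition _ := [Choice of LpiType by <:].
HB.instance Definition _ := [SubChoice_isSubLmodule of LpiType by <:].

Lemma Lpi_mem (u : LpiType) : Lpi pi u.
Proof. by apply: set_mem; exact: (valP u). Qed.

Definition inLpi g (Lg : Lpi pi g) : LpiType := MkLpi _ (mem_set Lg).

Definition dotL (u v : LpiType) : R := fine (pi_dot pi u v).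

Lemma dotLE (u v : LpiType) : (dotL u v)%:E = pi_dot pi u v.
Proof. by rewrite -pi_dot_fin//; exact: Lpi_mem. Qed.

Lemma dotLC (u v : LpiType) : dotL u v = dotL v u.
Proof. by rewrite /dotL /pi_dot; under eq_integral do rewrite dotvC. Qed.

Lemma dotL_ge0 (u : LpiType) : 0 <= dotL u u.
Proof. by rewrite -lee_fin dotLE pi_dot_ge0. Qed.

Lemma dotL_lin a (u v w : LpiType) : dotL (a *: u + v) w = a * dotL u w + dotL v w.
Proof.
apply: EFin_inj; rewrite EFinD EFinM !dotLE /pi_dot.
have iuw := Lpi_integrable _ _ (Lpi_mem u) (Lpi_mem w).
rewrite -integralZl// -integralD//; last 2 first.
- exact: integrableZl.
- exact: Lpi_integrable (Lpi_mem v) (Lpi_mem w).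
by apply: eq_integral => t _; rewrite -EFinM -EFinD -dotv_lin.
Qed.

Lemma ae_eq_dotL (u v w : LpiType) : Lpi_fun u = Lpi_fun v %[ae pi] -> dotL u w = dotL v w.
Proof.
move=> uv; congr fine; apply: ae_eq_integral => //.
- by apply/measurable_EFinP; exact: Lpi_measurable (Lpi_mem u) (Lpi_mem w).
- by apply/measurable_EFinP; exact: Lpi_measurable (Lpi_mem v) (Lpi_mem w).
apply: (@filterS _ _ (ae_filter_ringOfSetsType pi)) uv => t /= uv _.
by rewrite (uv I).
Qed.

End Lpi_theory.

Section max_sqr.
Variable R : realType.

Lemma sqr_max_norm (a b : R) :
  Num.max `|a| `|b| ^+ 2 = Num.max (a ^+ 2) (b ^+ 2).
Proof.
rewrite -(real_normK (num_real a)) -(real_normK (num_real b)).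
have [ab|/ltW ba] := leP `|a| `|b|.
  by rewrite max_r// lerXn2r ?nnegrE.
by rewrite max_l// lerXn2r ?nnegrE.
Qed.

Lemma norm_between_le (a b x q : R) : 0 <= q -> a * q <= x <= b * q ->
  `|x| <= Num.max `|b| `|a| * q.
Proof.
move=> q0 /andP[ax xb]; rewrite ler_norml; apply/andP; split.
  apply: le_trans ax; rewrite -mulNr ler_wpM2r// lerNl le_max.
  by rewrite orbC -normrN ler_norm.
by apply: le_trans xb _; rewrite ler_wpM2r// le_max ler_norm.
Qed.

End max_sqr.

(** * Norm bounds on L^pi from the real spectrum *)

Section Lpi_operators.
Variables (R : realType) (m : nat) (pi : probability (borelRV R m) R).
Local Notation LT := (LpiType R m pi).
Local Notation dotL := (dotL R m pi).
Local Notation q u := (dotL u u).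

Definition Lpi_op (G : ('rV[R]_m -> 'rV[R]_m) -> ('rV[R]_m -> 'rV[R]_m))
    (LG : forall g, Lpi pi g -> Lpi pi (G g)) (u : LT) : LT :=
  inLpi R m pi _ (LG u (Lpi_mem R m pi u)).

Lemma pi_norm_sqrL (u : LT) : (pi_norm pi u ^+ 2 = (q u)%:E)%E.
Proof. by rewrite pi_norm_sqr dotLE. Qed.

Variables (G : ('rV[R]_m -> 'rV[R]_m) -> ('rV[R]_m -> 'rV[R]_m)).
Hypothesis LG : forall g, Lpi pi g -> Lpi pi (G g).
Hypothesis saG : self_adjoint pi G.
Local Notation T := (Lpi_op G LG).

Lemma symmetric_Lpi_op : symmetric_op R LT dotL T.
Proof.
move=> u v; apply: EFin_inj; rewrite !dotLE.
exact: saG (Lpi_mem _ _ _ u) (Lpi_mem _ _ _ v).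
Qed.

Lemma resolvent_set_weak lam :
  resolvent_set pi G lam -> weak_resolvent R LT dotL T lam.
Proof.
move=> [B [[LB _] [c hc] GB BG]]; exists (Lpi_op B LB), (c ^+ 2); split.
- by move=> y z; apply: ae_eq_dotL; exact: GB (Lpi_mem _ _ _ y).
- by move=> y z; apply: ae_eq_dotL; exact: BG (Lpi_mem _ _ _ y).
move=> y; rewrite -lee_fin EFinM -!pi_norm_sqrL.
have := hc _ (Lpi_mem _ _ _ y).
have fin (u : LT) : pi_norm pi u = (Num.sqrt (q u))%:E.
  have [_ fu] := Lpi_mem _ _ _ u.
  have u0 : (0 <= pi_norm pi u)%E by exact: sqrte_ge0.
  have /fineK uE : pi_norm pi u \is a fin_num by rewrite ge0_fin_numE.
  rewrite -uE; congr EFin; have := pi_norm_sqrL u.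
  rewrite -uE -EFin_expe => -[<-].
  by rewrite sqrtr_sqr ger0_norm// fine_ge0.
rewrite !(fin y) (fin (Lpi_op B LB y)) -!EFin_expe -!EFinM !lee_fin -exprMn => h.
(* The constant c carries no sign, but its product with the root of q y dominates a square root and
   is thus nonnegative, so squaring is legitimate. *)
by rewrite lerXn2r ?nnegrE ?sqrtr_ge0// (le_trans _ h) ?sqrtr_ge0.
Qed.

Variables lmin lmax : R.
Hypothesis spG : forall lam, spectrum pi G lam -> lmin <= lam <= lmax.

Let outside_spectrum lam : ~~ (lmin <= lam <= lmax) -> weak_resolvent R LT dotL T lam.
Proof.
move=> /negP out; apply: resolvent_set_weak; apply: contrapT => h.
by apply: out; exact: spG.
Qed.

Lemma Lpi_op_range u : lmin * q u <= dotL (T u) u <= lmax * q u.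
Proof.
apply/andP; split.
  apply: (numerical_range_ge _ _ _ (dotLC _ _ _) (dotL_lin _ _ _) (dotL_ge0 _ _ _)) => //.
    exact: symmetric_Lpi_op.
  by move=> lam h; apply: outside_spectrum; rewrite leNgt h.
apply: (numerical_range_le _ _ _ (dotLC _ _ _) (dotL_lin _ _ _) (dotL_ge0 _ _ _)) => //.
  exact: symmetric_Lpi_op.
by move=> lam h; apply: outside_spectrum; rewrite andbC leNgt h.
Qed.

Lemma Lpi_op_norm_le u : q (T u) <= Num.max (lmax ^+ 2) (lmin ^+ 2) * q u.
Proof.
rewrite -sqr_max_norm.
apply: (symmetric_norm_le _ _ _ (dotLC _ _ _) (dotL_lin _ _ _)).
- exact: symmetric_Lpi_op.
- by rewrite le_max normr_ge0.
by move=> x; apply: norm_between_le (dotL_ge0 _ _ _ x) (Lpi_op_range x).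
Qed.

(** The map 1 - T is symmetric and its form lies between 1 - lmax and 1 - lmin; the endpoints trade
    places, hence [maxC]. *)
Lemma Lpi_op_compl_norm_le u :
  q (u - T u) <= Num.max ((1 - lmax) ^+ 2) ((1 - lmin) ^+ 2) * q u.
Proof.
have lin := dotL_lin R m pi; have C := dotLC R m pi.
pose S v := v - T v.
have symS : symmetric_op R LT dotL S.
  by move=> v w; rewrite /S !(dotE _ _ _ C lin) symmetric_Lpi_op.
rewrite -[u - _]/(S u) maxC -sqr_max_norm.
apply: (symmetric_norm_le _ _ _ C lin) => [//||x].
  by rewrite le_max normr_ge0.
apply: norm_between_le (dotL_ge0 _ _ _ x) _.
have := Lpi_op_range x; rewrite /S !(dotE _ _ _ C lin) => h; lra.
Qed.

End Lpi_operators.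

(** * Joint measurability of the gradient *)

Lemma continuous_addr (K : numFieldType) (V : normedModType K) (c : V) :
  continuous (fun t => t + c).
Proof. by move=> t; apply: cvgD; [exact: cvg_id|exact: cvg_cst]. Qed.

Section gradient.
Variables (R : realType) (m : nat) (d : measure_display) (Z : measurableType d)
  (l : 'rV[R]_m -> Z -> R).
Hypothesis l_meas : measurable_fun [set: borelRV R m * Z] (fun p => l p.1 p.2).
Hypothesis l_diff : forall z theta, differentiable (fun t => l t z) theta.

Lemma grad_emp_risk n (zs : 'I_n -> Z) t j :
  grad (emp_risk l zs) t 0 j = n%:R^-1 * \sum_i grad (fun t => l t (zs i)) t 0 j.
Proof.
rewrite mxE; under eq_bigr do rewrite mxE.
have -> : emp_risk l zs = n%:R^-1 \*: (\sum_i (fun t => l t (zs i))).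
  by apply/funext => u; rewrite /emp_risk fct_sumE.
have dl i : derivable (fun t => l t (zs i)) t (delta_mx 0 j).
  exact: diff_derivable.
by rewrite deriveZ ?derive_sum//; exact: derivable_sum.
Qed.

Lemma measurable_shift (c : 'rV[R]_m) :
  measurable_fun [set: borelRV R m] (fun t : borelRV R m => (t + c : borelRV R m)).
Proof.
apply: (@measurability _ _ (borelRV R m) (borelRV R m) _ _ (@open 'rV[R]_m)) => //.
move=> _ [U oU <-]; rewrite setTI; apply: sub_sigma_algebra.
apply: (@open_comp _ _ (fun t : 'rV[R]_m => t + c)) => // t _.
exact: continuous_addr.
Qed.

(** A partial derivative is the pointwise limit of difference quotients with steps 1 / (k + 1).
    These are jointly measurable in theta and z because translations are Borel. *)
Lemma measurable_grad j :
  measurable_fun [set: borelRV R m * Z] (fun p => grad (fun t => l t p.2) p.1 0 j).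
Proof.
pose v : 'rV[R]_m := delta_mx 0 j.
pose h (k : nat) (p : borelRV R m * Z) : R :=
  k.+1%:R * (l ((p.1 : 'rV[R]_m) + k.+1%:R^-1 *: v) p.2 - l p.1 p.2).
apply: (@measurable_fun_cvg _ _ _ _ h) => [k|p _].
  apply: measurable_funM; first exact: measurable_cst.
  apply: measurable_funB => //.
  apply: (measurableT_comp (f := fun p : borelRV R m * Z => l p.1 p.2)
    (g := fun p : borelRV R m * Z =>
      ((p.1 : 'rV[R]_m) + k.+1%:R^-1 *: v : borelRV R m, p.2))) => //.
  apply: measurable_fun_pair => //.
  by apply: (measurableT_comp (measurable_shift _)).
rewrite mxE -/v; pose f t := l t p.2; pose a : 'rV[R]_m := p.1.
have df : derivable f a v by apply: diff_derivable; exact: l_diff.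
have {}df : h^-1 *: ((f \o shift a) (h *: v) - f a) @[h --> (0 : R)^'] --> 'D_v f a.
  exact: df.
have /cvgr_dnbhsP/(_ (@harmonic R)) := df.
have harm0 k : harmonic k != 0 :> R by rewrite gt_eqF ?harmonic_gt0.
move=> /(_ (conj harm0 cvg_harmonic)).
apply: cvg_trans; apply: near_eq_cvg; near=> k.
by rewrite /h /= invrK (addrC (_ *: v)).
Unshelve. all: by end_near. Qed.

End gradient.

(** * Strong measurability *)

Section strong_measurability.
Variables (R : realType) (V : lmodType R) (dot : V -> V -> R).
Hypothesis dotC : forall u v, dot u v = dot v u.
Hypothesis dot_lin : forall a u v w, dot (a *: u + v) w = a * dot u w + dot v w.
Hypothesis dot_ge0 : forall u, 0 <= dot u u.
Variables (d : measure_display) (Omega : measurableType d).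
Local Notation q u := (dot u u).
Implicit Types u v : Omega -> V.

(* Closing under limits makes bounded bilinear expressions of such functions
   measurable by induction, with no appeal to the separability of V. *)
Inductive strongly_measurable : (Omega -> V) -> Prop :=
| smeas_indic B x : measurable B -> strongly_measurable (fun w => \1_B w *: x)
| smeas_add u v : strongly_measurable u -> strongly_measurable v ->
    strongly_measurable (fun w => u w + v w)
| smeas_lim (u_ : nat -> Omega -> V) u :
    (forall n, strongly_measurable (u_ n)) ->
    (forall w, q (u_ n w - u w) @[n --> \oo] --> 0) ->
    strongly_measurable u.

Lemma smeas_cst x : strongly_measurable (fun=> x).
Proof.
have := smeas_indic setT x measurableT.
by under eq_fun do rewrite indicT scale1r.
Qed.

Lemma smeas_scale a u : strongly_measurable u ->
  strongly_measurable (fun w => a *: u w).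
Proof.
elim=> [B x mB|{}u v _ IHu _ IHv|u_ {}u _ IH cu].
- have := smeas_indic B (a *: x) mB.
  by under eq_fun do rewrite scalerA mulrC -scalerA.
- under eq_fun do rewrite scalerDr.
  exact: smeas_add.
- apply: smeas_lim IH _ => w.
  under eq_fun do rewrite -scalerBr (dotZ _ _ _ dot_lin) (dotZr _ _ _ dotC dot_lin) mulrA.
  rewrite -(mulr0 (a * a)).
  by apply: cvgM (cu w); exact: cvg_cst.
Qed.

Lemma smeas_sum (I : Type) (s : seq I) (u_ : I -> Omega -> V) :
  (forall i, strongly_measurable (u_ i)) ->
  strongly_measurable (fun w => \sum_(i <- s) u_ i w).
Proof.
move=> mu; elim: s => [|i s IH].
  by under eq_fun do rewrite big_nil; exact: smeas_cst.
by under eq_fun do rewrite big_cons; exact: smeas_add.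
Qed.

(** Cauchy-Schwarz with C = q y + 1 in place of q y, so that the factor is positive even if q y = 0:
    expand the square of <x, y> y - C x. *)
Lemma dot_sqr_le x y : dot x y ^+ 2 <= (q y + 1) * q x.
Proof.
set C := q y + 1; have C0 : 0 < C by rewrite ltr_wpDl ?dot_ge0.
rewrite -(ler_pM2l C0).
have := dot_ge0 (dot x y *: y - C *: x).
rewrite !(dotE _ _ _ dotC dot_lin) (dotC y x) => h.
have := sqr_ge0 (dot x y); rewrite /C in h *; lra.
Qed.

Variable b : V -> V -> R.
Hypothesis bC : forall x y, b x y = b y x.
Hypothesis b_lin : forall a x y z, b (a *: x + y) z = a * b x z + b y z.
Hypothesis b_cont : forall y, exists C, forall x, b x y ^+ 2 <= C * q x.

Lemma bounded_form_cvg (x_ : nat -> V) x y :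
  q (x_ n - x) @[n --> \oo] --> 0 -> b (x_ n) y @[n --> \oo] --> b x y.
Proof.
move=> cx; have [C hC] := b_cont y.
have C'0 : 0 < `|C| + 1 by rewrite ltr_wpDl.
apply/cvgrPdist_lt => e e0.
have e1 : 0 < e ^+ 2 / (`|C| + 1) by rewrite divr_gt0// exprn_gt0.
move/cvgr0Pnorm_lt: cx => /(_ _ e1); apply: filterS => n.
rewrite ger0_norm ?dot_ge0// ltr_pdivlMr// => hn.
rewrite distrC -(ltr_pXn2r (n := 2)) ?nnegrE ?normr_ge0 ?(ltW e0)//.
have -> : b (x_ n) y - b x y = b (x_ n - x) y.
  by rewrite (addrC (x_ n)) -scaleN1r b_lin; ring.
rewrite real_normK ?num_real//; apply: le_lt_trans (hC _) _.
apply: le_lt_trans hn; rewrite mulrC ler_wpM2l ?dot_ge0//.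
by apply: le_trans (ler_norm C) _; rewrite lerDl.
Qed.

(** Induction on u, then on v when u is an indicator times a fixed x. By symmetry b is continuous in
    each argument separately, so both inductions pass to the limit. *)
Lemma measurable_bounded_form u v :
  strongly_measurable u -> strongly_measurable v ->
  measurable_fun setT (fun w => b (u w) (v w)).
Proof.
have b_add x y z : b (x + y) z = b x z + b y z.
  by have := b_lin 1 x y z; rewrite scale1r mul1r.
have b0 z : b 0 z = 0 by have := b_add 0 0 z; rewrite addr0; lra.
have b_scale a x z : b (a *: x) z = a * b x z.
  by have := b_lin a x 0 z; rewrite addr0 b0 addr0.
move=> mu; elim: mu v => {u} [B x mB|u1 u2 _ IH1 _ IH2|u_ u _ IH cu] v mv.
- under eq_fun do rewrite b_scale.
  apply: measurable_funM; first exact: measurable_indic.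
  under eq_fun do rewrite bC.
  elim: mv => {v} [B' y mB'|v1 v2 _ IH1 _ IH2|v_ v _ IH cv].
  + under eq_fun do rewrite b_scale.
    by apply: measurable_funM; [exact: measurable_indic|exact: measurable_cst].
  + under eq_fun do rewrite b_add.
    exact: measurable_funD.
  + apply: (@measurable_fun_cvg _ _ _ _ (fun n w => b (v_ n w) x)) => // w _.
    exact: bounded_form_cvg.
- under eq_fun do rewrite b_add.
  by apply: measurable_funD; [exact: IH1|exact: IH2].
- apply: (@measurable_fun_cvg _ _ _ _ (fun n w => b (u_ n w) (v w))) => [n|w _].
    exact: IH.
  exact: bounded_form_cvg.
Qed.

End strong_measurability.

(** * Jointly measurable kernels as strongly measurable maps into L^pi *)

Section kernels.
Variables (R : realType) (m : nat) (pi : probability (borelRV R m) R).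
Local Notation LT := (LpiType R m pi).
Local Notation dotL := (dotL R m pi).
Local Notation q u := (dotL u u).

Lemma Lpi_le (g h : 'rV[R]_m -> 'rV[R]_m) :
  (forall j, measurable_fun [set: borelRV R m] (fun t => g t 0 j)) ->
  Lpi pi h -> (forall t, dotv (g t) (g t) <= dotv (h t) (h t)) -> Lpi pi g.
Proof.
move=> mg Lh gh; apply/LpiP; split=> //; have [_ ih] := (LpiP _ _ _ h).1 Lh.
apply: (le_integrable _ _ _ ih) => //.
  apply/measurable_EFinP/measurable_sum => j.
  by apply: measurable_funM; exact: mg.
by move=> t _; rewrite lee_fin !ger0_norm ?dotv_ge0.
Qed.

Lemma Lpi_dominated_cvg (u_ : nat -> LT) (u h : LT) :
  (forall n t, dotv (u_ n t - u t) (u_ n t - u t) <= dotv (h t) (h t)) ->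
  (forall t, dotv (u_ n t - u t) (u_ n t - u t) @[n --> \oo] --> 0) ->
  q (u_ n - u) @[n --> \oo] --> 0.
Proof.
move=> dom cu; have [_ ih] := (LpiP _ _ _ h).1 (Lpi_mem _ _ _ h).
have L n := Lpi_mem _ _ _ (u_ n - u).
have : (\int[pi]_t (dotv ((u_ n - u) t) ((u_ n - u) t))%:E)%E @[n --> \oo]
       --> (\int[pi]_t (0 : R)%:E)%E.
  apply: (@dominated_cvg _ _ _ pi setT measurableT _ _
    (fun t => (dotv (h t) (h t))%:E)) => //.
  - move=> n; apply/measurable_EFinP.
    exact: Lpi_measurable (L n) (L n).
  - by move=> t _; apply: cvg_EFin; [exact: nearW|exact: cu].
  - by move=> n t _; rewrite lee_fin ger0_norm ?dotv_ge0//; exact: dom.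
rewrite integral0 => /fine_cvg.
exact: cvg_trans.
Qed.

Section coordinate.
Variable j : 'I_m.
Local Notation e := (delta_mx 0 j : 'rV[R]_m).

Lemma dotv_delta (x y : R) : dotv (x *: e) (y *: e) = x * y.
Proof.
rewrite /dotv (bigD1 j)//= !mxE !eqxx !mulr1 big1 ?addr0// => i ij.
by rewrite !mxE (negbTE ij) andbF mulr0 mul0r.
Qed.

(** Square integrability of a scalar function, phrased through the j-th basis vector so as to
    inherit the closure properties of [Lpi]. *)
Definition sqrint (f : 'rV[R]_m -> R) := Lpi pi (fun t => f t *: e).

Lemma sqrint_le (f g : 'rV[R]_m -> R) :
  measurable_fun [set: borelRV R m] f -> sqrint g ->
  (forall t, `|f t| <= `|g t|) -> sqrint f.
Proof.
move=> mf Lg fg; apply: Lpi_le Lg _ => [i|t].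
  under eq_fun do rewrite mxE.
  by apply: measurable_funM => //; exact: measurable_cst.
rewrite !dotv_delta -!expr2 -[leLHS]real_normK ?num_real//.
by rewrite -[leRHS]real_normK ?num_real// lerXn2r ?nnegrE.
Qed.

Lemma sqrint_lin a (f g : 'rV[R]_m -> R) :
  sqrint f -> sqrint g -> sqrint (fun t => a * f t + g t).
Proof.
rewrite /sqrint => Lf Lg.
have -> : (fun t => (a * f t + g t) *: e) =
    a *: (fun t => f t *: e) + (fun t => g t *: e).
  by apply/funext => t; rewrite scalerDl -scalerA.
apply: set_mem; have := @rpredD _ (Lpi_pred R m pi).
by apply; [apply: rpredZ|]; exact: mem_set.
Qed.

Lemma sqrint_cst (a : R) : sqrint (fun=> a).
Proof.
apply/LpiP; split=> [i|]; first exact: measurable_cst.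
under eq_fun do rewrite dotv_delta.
exact: finite_measure_integrable_cst.
Qed.

Lemma sqrint_bounded (f : 'rV[R]_m -> R) (a : R) :
  measurable_fun [set: borelRV R m] f -> (forall t, `|f t| <= a) -> sqrint f.
Proof.
move=> mf fa; apply: sqrint_le mf (sqrint_cst a) _ => t.
exact: le_trans (fa t) (ler_norm _).
Qed.

(* Outside of L^pi the value is the junk element 0. *)
Definition lift_coord (f : 'rV[R]_m -> R) : LT :=
  if pselect (sqrint f) is left Lf then inLpi R m pi _ Lf else 0.

Lemma lift_coordE f : sqrint f -> forall t, lift_coord f t = f t *: e.
Proof. by move=> Lf t; rewrite /lift_coord; case: pselect. Qed.

Lemma lift_coord_lin a f g : sqrint f -> sqrint g ->
  lift_coord (fun t => a * f t + g t) = a *: lift_coord f + lift_coord g.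
Proof.
move=> Lf Lg; apply: val_inj; apply/funext => t /=.
transitivity (a *: lift_coord f t + lift_coord g t); last by [].
by rewrite !lift_coordE ?scalerDl ?scalerA//; exact: sqrint_lin.
Qed.

Lemma lift_coord_dominated_cvg (f_ : nat -> 'rV[R]_m -> R) f g :
  (forall n, sqrint (f_ n)) -> sqrint f -> sqrint g ->
  (forall n t, `|f_ n t - f t| <= `|g t|) ->
  (forall t, f_ n t @[n --> \oo] --> f t) ->
  q (lift_coord (f_ n) - lift_coord f) @[n --> \oo] --> 0.
Proof.
move=> Lfn Lf Lg dom cf; apply: (@Lpi_dominated_cvg _ _ (lift_coord g)) => [n t|t].
  rewrite !lift_coordE// -scalerBl !dotv_delta -!expr2.
  rewrite -[leLHS]real_normK ?num_real//.
  by rewrite -[leRHS]real_normK ?num_real// lerXn2r ?nnegrE.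
under eq_fun do rewrite !lift_coordE// -scalerBl dotv_delta.
rewrite -(mulr0 0); apply: cvgM; rewrite -(subrr (f t));
  by apply: cvgB => //; exact: cvg_cst.
Qed.

Variables (d : measure_display) (Omega : measurableType d).
Local Notation smeas := (strongly_measurable R LT dotL d Omega).
Local Notation prodT := (borelRV R m * Omega)%type.
Implicit Types k : prodT -> R.

Lemma measurable_section k w : measurable_fun setT k ->
  measurable_fun [set: borelRV R m] (fun t => k (t, w)).
Proof. by move=> mk; apply: measurableT_comp mk _; exact: pair2_measurable. Qed.

Let smeasK k := smeas (fun w => lift_coord (fun t => k (t, w))).

Let sqrint_indic (S : set prodT) w : measurable S -> sqrint (fun t => \1_S (t, w)).
Proof.
move=> mS; apply: (@sqrint_bounded _ 1).
  by apply: measurable_section; exact: measurable_indic.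
by move=> t; rewrite indicE; case: (_ \in _); rewrite ?normr0 ?normr1.
Qed.

Let smeasK_rect (A : set (borelRV R m)) (B : set Omega) :
  measurable A -> measurable B -> smeasK \1_(A `*` B).
Proof.
move=> mA mB; have := smeas_indic R LT dotL d Omega B (lift_coord \1_A) mB.
congr smeas; apply/funext => w; apply: val_inj; apply/funext => t.
have sA : sqrint \1_A.
  apply: (@sqrint_bounded _ 1); first exact: measurable_indic.
  by move=> s; rewrite indicE; case: (_ \in _); rewrite ?normr0 ?normr1.
rewrite /= (lift_coordE _ (sqrint_indic _ w (measurableX mA mB))).
transitivity (\1_B w *: lift_coord \1_A t); first by [].
by rewrite lift_coordE// scalerA !indicE in_setX/= mulrC -natrM mulnb.
Qed.

Let smeasK_lin a k1 k2 :
  (forall w, sqrint (fun t => k1 (t, w))) ->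
  (forall w, sqrint (fun t => k2 (t, w))) ->
  smeasK k1 -> smeasK k2 -> smeasK (fun p => a * k1 p + k2 p).
Proof.
move=> s1 s2 m1 m2; rewrite /smeasK.
under eq_fun do rewrite lift_coord_lin//.
apply: smeas_add => //.
by apply: smeas_scale; [exact: dotLC|exact: dotL_lin|].
Qed.

Let smeasK_cvg (k_ : nat -> prodT -> R) k (g : prodT -> R) :
  (forall n w, sqrint (fun t => k_ n (t, w))) ->
  (forall w, sqrint (fun t => k (t, w))) ->
  (forall w, sqrint (fun t => g (t, w))) ->
  (forall n p, `|k_ n p - k p| <= `|g p|) ->
  (forall p, k_ n p @[n --> \oo] --> k p) ->
  (forall n, smeasK (k_ n)) -> smeasK k.
Proof.
move=> sk_ sk sg dom ck mk; apply: smeas_lim mk _ => w.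
by apply: (@lift_coord_dominated_cvg _ _ (fun t => g (t, w))).
Qed.

(** Dynkin's theorem: rectangles generate the product sigma-algebra and are stable under
    intersection. A countable disjoint union is the limit of its finite partial unions, with the
    constant 1 as dominating function. *)
Let smeasK_indic (S : set prodT) : measurable S -> smeasK \1_S.
Proof.
have smeasK_T : smeasK \1_setT.
  by rewrite -(@setXTT (borelRV R m) Omega); exact: smeasK_rect.
move=> mS; pose P := [set C : set prodT | measurable C /\ smeasK \1_C].
suff : P S by case.
have E := measurable_prod_measurableType (borelRV R m) Omega.
apply: (dynkin_induction (P := P) E); last by rewrite -E.
- move=> _ _ [A mA [B mB <-]] [A' mA' [B' mB' <-]]; rewrite -setXI.
  exists (A `&` A'); first exact: measurableI.
  by exists (B `&` B') => //; exact: measurableI.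
- by [].
- move=> _ [A mA [B mB <-]]; split; first exact: measurableX.
  exact: smeasK_rect.
- move=> C mC [_ sC]; split; first exact: measurableC.
  have -> : \1_(~` C) = (fun p => -1 * \1_C p + \1_setT p) :> (prodT -> R).
    apply/funext => p; rewrite !indicE in_setC in_setT; case: (_ \in _) => /=; lra.
  apply: smeasK_lin => //; try by move=> w; exact: sqrint_indic.
move=> F mF tF sF; split; first exact: bigcupT_measurable.
pose U n := \bigcup_(i < n) F i.
have mU n : measurable (U n) by exact: bigcup_measurable.
have UF n p : (\1_(U n.+1) p = \1_(F n) p + \1_(U n) p :> R).
  rewrite /U bigcup_mkord big_ord_recr/= -bigcup_mkord !indicE in_setU.
  have [Up|_] := boolP (p \in _); last by rewrite orFb addr0.
  have [Fp|_] := boolP (p \in F n); last by rewrite add0r.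
  move: Up Fp => /set_mem[i /= ilt Fi] /set_mem Fn.
  have := tF i n I I (ex_intro _ p (conj Fi Fn)) => ni.
  by rewrite ni ltnn in ilt.
have sU n : smeasK \1_(U n).
  elim: n => [|n IH].
    have -> : U 0%N = setT `*` set0 :> set prodT.
      by rewrite setX0 /U bigcup_mkord big_ord0.
    exact: smeasK_rect.
  have -> : \1_(U n.+1) = (fun p => 1 * \1_(F n) p + \1_(U n) p) :> (prodT -> R).
    by apply/funext => p; rewrite mul1r UF.
  apply: smeasK_lin => //; try by move=> w; exact: sqrint_indic.
  by case: (sF n).
apply: (@smeasK_cvg (fun n => \1_(U n)) _ (cst 1)) => //.
- by move=> n w; exact: sqrint_indic.
- by move=> w; apply: sqrint_indic; exact: bigcupT_measurable.
- by move=> w; exact: sqrint_cst.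
- move=> n p; rewrite !indicE normr1.
  case: (_ \in _); case: (_ \in _); rewrite ?subrr ?normr0 ?subr0 ?sub0r ?normrN ?normr1//.
move=> p; apply: cvg_near_cst; have [pF|pF] := pselect ((\bigcup_k F k) p).
  have [i _ Fi] := pF; near=> n.
  rewrite !indicE !mem_set//; exists i => //=.
  by near: n; exact: nbhs_infty_gt.
apply: nearW => n; rewrite !indicE !memNset// => -[i _ Fi].
by apply: pF; exists i.
Unshelve. all: by end_near. Qed.

Let smeasK_nnsfun (g : {nnsfun prodT >-> R}) : smeasK (fun p => g p).
Proof.
have sg (s : seq R) : smeasK (fun p => \sum_(y <- s) y * \1_(g @^-1` [set y]) p)
    /\ forall w, sqrint (fun t => \sum_(y <- s) y * \1_(g @^-1` [set y]) (t, w)).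
  elim: s => [|y s [IH1 IH2]].
    split=> [|w]; last by under eq_fun do rewrite big_nil; exact: sqrint_cst.
    have -> : (fun p => \sum_(y <- [::]) y * \1_(g @^-1` [set y]) p) =
        \1_(setT `*` set0) :> (prodT -> R).
      by apply/funext => p; rewrite big_nil setX0 indic0.
    exact: smeasK_rect.
  split=> [|w]; last first.
    by under eq_fun do rewrite big_cons; apply: sqrint_lin => //; exact: sqrint_indic.
  under eq_fun do rewrite big_cons.
  apply: smeasK_lin => //; first by move=> w; exact: sqrint_indic.
  exact: smeasK_indic.
have -> : (fun p : prodT => g p) =
    (fun p => \sum_(y <- finmap.enum_fset (fset_set (range g))) y * \1_(g @^-1` [set y]) p).
  by apply/funext => p; rewrite {1}fimfunE fsbig_finite.
by case: (sg (finmap.enum_fset (fset_set (range g)))).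
Qed.

Let smeasK_ge0 k : measurable_fun setT k -> (forall p, 0 <= k p) ->
  (forall w, sqrint (fun t => k (t, w))) -> smeasK k.
Proof.
move=> mk k0 sk.
have mEk : measurable_fun setT (EFin \o k) by exact/measurable_EFinP.
have [g_ [g_nd g_cvg]] := approximation measurableT mEk (fun p _ => k0 p : (0 <= (k p)%:E)%E).
have ck p : g_ n p @[n --> \oo] --> k p.
  by have /fine_cvg := g_cvg p I.
have gk n p : g_ n p <= k p.
  rewrite -(cvg_lim _ (ck p))//; apply: (nondecreasing_cvgn_le (u_ := fun n => g_ n p)).
    by move=> a b /g_nd/lefP/(_ p).
  by apply/cvg_ex; exists (k p).
have sg n w : sqrint (fun t => g_ n (t, w)).
  apply: sqrint_le (sk w) _ => [|t]; first exact: measurable_section.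
  by rewrite !ger0_norm ?gk.
(* As 0 <= g_ n <= k, the kernel k itself dominates the differences. *)
apply: (@smeasK_cvg (fun n p => g_ n p) k k) => //.
move=> n p; rewrite (ger0_norm (k0 p)) distrC ger0_norm ?subr_ge0 ?gk//.
by rewrite gerBl.
Qed.

Lemma strongly_measurable_coord k : measurable_fun setT k ->
  (forall w, sqrint (fun t => k (t, w))) ->
  smeas (fun w => lift_coord (fun t => k (t, w))).
Proof.
move=> mk sk; pose kp p := Num.max (k p) 0; pose kn p := Num.max (- k p) 0.
have mp : measurable_fun setT kp by apply: measurable_maxr.
have mn : measurable_fun setT kn.
  by apply: measurable_maxr => //; exact: measurable_funN.
have sp w : sqrint (fun t => kp (t, w)).
  apply: sqrint_le (sk w) _ => [|t]; first exact: measurable_section.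
  by rewrite /kp; case: (leP (k (t, w)) 0); rewrite ?normr0.
have sn w : sqrint (fun t => kn (t, w)).
  apply: sqrint_le (sk w) _ => [|t]; first exact: measurable_section.
  by rewrite /kn; case: (leP (- k (t, w)) 0); rewrite ?normr0 ?normrN.
have -> : k = fun p => -1 * kn p + kp p.
  apply/funext => p; rewrite /kn /kp; case: (leP (- k p) 0); case: (leP (k p) 0); lra.
by apply: smeasK_lin => //; apply: smeasK_ge0 => // p; rewrite le_max lexx orbT.
Qed.

End coordinate.

(** A vector-valued kernel is the finite sum of its lifted coordinates, and each coordinate is a
    scalar kernel. *)
Lemma strongly_measurable_kernel (d : measure_display) (Omega : measurableType d)
    (u : Omega -> LT) :
  (forall j, measurable_fun [set: borelRV R m * Omega] (fun p => u p.2 p.1 0 j)) ->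
  strongly_measurable R LT dotL d Omega u.
Proof.
move=> mu.
have su j w : sqrint j (fun t => u w t 0 j).
  apply: Lpi_le (Lpi_mem _ _ _ (u w)) _ => [i|t].
    under eq_fun do rewrite mxE.
    apply: measurable_funM; last exact: measurable_cst.
    by case: (Lpi_mem _ _ _ (u w)).
  rewrite dotv_delta /dotv (bigD1 j)//= lerDl.
  by apply: sumr_ge0 => i _; rewrite -expr2 sqr_ge0.
have -> : u = fun w => \sum_j lift_coord j (fun t => u w t 0 j).
  apply/funext => w; apply: val_inj; apply/funext => t.
  transitivity (\sum_j lift_coord j (fun t => u w t 0 j) t).
    under eq_bigr do rewrite lift_coordE//.
    exact: row_sum_delta.
  by elim/big_ind2 : _ => // x1 x2 y1 y2 -> ->.
apply: smeas_sum => j.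
exact: (strongly_measurable_coord j d Omega (fun p => u p.2 p.1 0 j) (mu j) (su j)).
Qed.
End kernels.

(** * Means of i.i.d. samples *)

Section iid_mean.
Variables (R : realType) (d d' : measure_display) (Omega : measurableType d)
  (Z : measurableType d') (P : probability Omega R) (D : probability Z R)
  (n : nat) (zs : 'I_n -> {RV P >-> Z}).
Hypothesis iid_zs : iid D zs.

Lemma iid_ge0_integral i (f : Z -> R) : measurable_fun setT f ->
  (forall z, 0 <= f z) -> (\int[P]_w (f (zs i w))%:E = \int[D]_z (f z)%:E)%E.
Proof.
move=> mf f0.
rewrite -(ge0_integral_distribution (zs i) (f := EFin \o f))//.
  by apply: eq_measure_integral => A mA _; apply: iid_zs.2.
exact/measurable_EFinP.
Qed.

Lemma iid_integrable i (f : Z -> R) :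
  D.-integrable setT (fun z => (f z)%:E) ->
  P.-integrable setT (fun w => (f (zs i w))%:E).
Proof.
move=> /integrableP[/measurable_EFinP mf foo]; apply/integrableP; split.
  by apply/measurable_EFinP; exact: measurableT_comp mf _.
rewrite (iid_ge0_integral i (fun z => `|f z|))//.
exact: measurableT_comp.
Qed.

Lemma iid_integral i (f : Z -> R) : D.-integrable setT (fun z => (f z)%:E) ->
  (\int[P]_w (f (zs i w))%:E = \int[D]_z (f z)%:E)%E.
Proof.
move=> fi; rewrite -(integral_distribution (X := zs i) (f := EFin \o f))//.
- by apply: eq_measure_integral => A mA _; apply: iid_zs.2.
- by case/integrableP: fi.
- exact: iid_integrable.
Qed.

Lemma iid_pair_law i k (A B : set Z) : i != k -> measurable A -> measurable B ->
  (P ((zs i @^-1` A) `&` (zs k @^-1` B)) = D A * D B)%E.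
Proof.
move=> ik mA mB; rewrite -(iid_zs.2 i _ mA) -(iid_zs.2 k _ mB).
pose E t := if t == i then A else B.
have := iid_zs.1 [set i; k]%SET E _; rewrite big_setU1 ?inE//= big_set1.
rewrite /E eqxx eq_sym (negbTE ik) => <-; last by move=> t; case: ifP.
congr (P _); apply/seteqP; split=> [w [Aw Bw] t /=|w h].
  by rewrite !inE => /orP[]/eqP ->; rewrite ?eqxx// eq_sym (negbTE ik).
by split; [have := h i|have := h k]; rewrite /= !inE eqxx ?orbT ?(eq_sym k) ?(negbTE ik); exact.
Qed.

(** The law of the pair (zs i, zs k) agrees with [D \x D] on rectangles, hence everywhere. By Fubini
    the inner integral is a multiple of the mean of y, which is zero. *)
Lemma iid_cross_integral i k (y : Z -> R) : i != k ->
  D.-integrable setT (fun z => (y z)%:E) -> (\int[D]_z (y z)%:E = 0)%E ->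
  P.-integrable setT (fun w => (y (zs i w) * y (zs k w))%:E) ->
  (\int[P]_w (y (zs i w) * y (zs k w))%:E = 0)%E.
Proof.
move=> ik iy y0 iyy; have [/measurable_EFinP my _] := integrableP _ _ _ iy.
have mX : measurable_fun setT (fun w => (zs i w, zs k w)).
  by apply: measurable_fun_pair.
pose X : {RV P >-> (Z * Z)%type} := mfun_Sub (mem_set mX).
pose f (p : Z * Z) := (y p.1 * y p.2)%:E.
have mf : measurable_fun setT f.
  by apply/measurable_EFinP/measurable_funM; exact: measurableT_comp.
have -> : (\int[P]_w (y (zs i w) * y (zs k w))%:E = \int[P]_w (f \o X) w)%E by [].
rewrite -integral_distribution//.
have law (A : set (Z * Z)) : measurable A -> distribution P X A = (D \x D)%E A.
  move=> mA; rewrite (@product_measure_unique _ _ _ _ _ D D (distribution P X))//.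
  move=> A1 A2 mA1 mA2; rewrite -(iid_pair_law _ _ _ _ ik)//.
rewrite (@eq_measure_integral _ _ _ _ (D \x D)%E); last first.
  by move=> A mA _; exact: law.
rewrite -integral12_prod_meas1.
  transitivity (\int[D]_z (0 : \bar R))%E; last exact: integral0.
  apply: eq_integral => z _; rewrite /fubini_F /f /=.
  by under eq_integral do rewrite EFinM; rewrite integralZl// y0 mule0.
have [_ oo] := integrableP _ _ _ iy.
apply/integrable12ltyP => //.
under eq_integral => z _.
  under eq_integral => z' _ do rewrite /= normrM EFinM.
  rewrite ge0_integralZl//; last by do 2 apply: measurableT_comp => //.
  over.
have yfin : (\int[D]_z `|(y z)%:E|)%E \is a fin_num.
  by rewrite ge0_fin_numE// integral_ge0.
rewrite ge0_integralZr//; first by rewrite lte_mul_pinfty// integral_ge0.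
- by do 2 apply: measurableT_comp => //.
- exact: integral_ge0.
Qed.

Lemma integrable_sqr_integrable (d0 : measure_display) (T : measurableType d0)
    (mu : probability T R) (f : T -> R) : measurable_fun setT f ->
  mu.-integrable setT (fun t => (f t ^+ 2)%:E) ->
  mu.-integrable setT (fun t => (f t)%:E).
Proof.
move=> mf if2.
apply: (le_integrable _ _ _
  (integrableD _ (finite_measure_integrable_cst mu (1 : R) measurableT) if2)) => //.
  exact/measurable_EFinP.
move=> t _; rewrite /= lee_fin [leRHS]ger0_norm ?addr_ge0 ?sqr_ge0//.
rewrite -(real_normK (num_real (f t))); have := sqr_ge0 (`|f t| - 1).
have := sqr_ge0 (`|f t|); have := normr_ge0 (f t); nra.
Qed.

Hypothesis n_gt0 : (0 < n)%N.
Let n_neq0 : n%:R != 0 :> R. Proof. by rewrite pnatr_eq0 -lt0n. Qed.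

(** The law of each sample being D, the mean-zero hypothesis passes from the sample average to y. In
    the squared sum S the off-diagonal terms vanish in mean and each of the n diagonal ones
    contributes s; division by n^2 leaves s / n. *)
Lemma iid_centered_mean_sqr (y : Z -> R) (a b : R) : measurable_fun setT y ->
  D.-integrable setT (fun z => (y z ^+ 2)%:E) ->
  (\int[P]_w (n%:R^-1 * \sum_i y (zs i w))%:E = 0)%E ->
  (\int[P]_w ((a * (n%:R^-1 * \sum_i y (zs i w)) - b) ^+ 2)%:E =
   (a ^+ 2)%:E * ((\int[D]_z (y z ^+ 2)%:E) * (n%:R^-1)%:E) + (b ^+ 2)%:E)%E.
Proof.
move=> my iy2 mean0.
have iy := integrable_sqr_integrable _ _ D y my iy2.
have [s sE] : exists s, (\int[D]_z (y z ^+ 2)%:E = s%:E)%E.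
  by exists (fine (\int[D]_z (y z ^+ 2)%:E)); rewrite fineK// integrable_fin_num.
have [c cE] : exists c, (\int[D]_z (y z)%:E = c%:E)%E.
  by exists (fine (\int[D]_z (y z)%:E)); rewrite fineK// integrable_fin_num.
pose m w := n%:R^-1 * \sum_i y (zs i w).
have im : P.-integrable setT (fun w => (m w)%:E).
  have /(integrableZl measurableT n%:R^-1) :
      P.-integrable setT (fun w => (\sum_i (y (zs i w))%:E)%E).
    by apply: integrable_sum => // i _; exact: iid_integrable.
  by apply: eq_integrable => // w _; rewrite sumEFin.
have intm : (\int[P]_w (m w)%:E = c%:E)%E.
  under eq_integral do rewrite EFinM -sumEFin.
  rewrite integralZl//; last first.
    by apply: integrable_sum => // i _; exact: iid_integrable.
  rewrite integral_sum//; last by move=> i; exact: iid_integrable.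
  under eq_bigr => i _ do rewrite iid_integral// cE.
  by rewrite sumEFin -EFinM sumr_const card_ord -[c *+ n]mulr_natl mulKf.
have c0 : c = 0 by apply: EFin_inj; rewrite -intm.
rewrite {}c0 in cE intm.
have iy2w i : P.-integrable setT (fun w => (y (zs i w) ^+ 2)%:E).
  exact: (iid_integrable i (fun z => y z ^+ 2)).
have iyy i k : P.-integrable setT (fun w => (y (zs i w) * y (zs k w))%:E).
  apply: (le_integrable _ _ _ (integrableD _ (iy2w i) (iy2w k))) => //.
    apply/measurable_EFinP/measurable_funM; exact: measurableT_comp.
  move=> w _; rewrite /= lee_fin [leRHS]ger0_norm ?addr_ge0 ?sqr_ge0// ler_norml.
  have := sqr_ge0 (y (zs i w) - y (zs k w)).
  have := sqr_ge0 (y (zs i w) + y (zs k w)).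
  have := sqr_ge0 (y (zs i w)); have := sqr_ge0 (y (zs k w)); lra.
pose S w := \sum_i \sum_k y (zs i w) * y (zs k w).
have iS' i : P.-integrable setT (fun w => (\sum_k (y (zs i w) * y (zs k w))%:E)%E).
  by apply: integrable_sum.
have iS : P.-integrable setT (fun w => (S w)%:E).
  have : P.-integrable setT (fun w => (\sum_i \sum_k (y (zs i w) * y (zs k w))%:E)%E).
    by apply: integrable_sum.
  apply: eq_integrable => // w _; rewrite /S -sumEFin.
  by apply: eq_bigr => i _; rewrite sumEFin.
have intS : (\int[P]_w (S w)%:E = (n%:R * s)%:E)%E.
  transitivity (\int[P]_w (\sum_i \sum_k (y (zs i w) * y (zs k w))%:E))%E.
    apply: eq_integral => w _; rewrite /S -sumEFin.
    by apply: eq_bigr => i _; rewrite sumEFin.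
  rewrite integral_sum//; under eq_bigr => i _.
    rewrite integral_sum// (bigD1 i)//= big1 ?adde0; last first.
      by move=> k ki; apply: iid_cross_integral => //; rewrite eq_sym.
    rewrite (iid_ge0_integral i (fun z => y z ^+ 2)) ?sE//.
    - over.
    - exact: measurable_funX.
    - by move=> z; exact: sqr_ge0.
  by rewrite /= sumEFin sumr_const card_ord mulr_natl.
pose A := a ^+ 2 * n%:R^-1 ^+ 2; pose B := - (2 * a * b).
have iA := integrableZl measurableT A iS; have iB := integrableZl measurableT B im.
transitivity (\int[P]_w ((A%:E * (S w)%:E + B%:E * (m w)%:E) + (b ^+ 2)%:E))%E.
  apply: eq_integral => w _; rewrite -!EFinM -!EFinD; congr EFin.
  have -> : S w = (\sum_i y (zs i w)) ^+ 2.
    by rewrite expr2 mulr_suml; apply: eq_bigr => i _; rewrite mulr_sumr.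
  by rewrite /A /B /m; ring.
rewrite integralD//; last 2 first.
- exact: integrableD.
- exact: finite_measure_integrable_cst.
rewrite integralD// !integralZl// intS intm mule0 adde0 integral_cst//=.
rewrite probability_setT mule1 sE -!EFinM -!EFinD; congr EFin.
by rewrite /A; field.
Qed.

(** An inequality suffices and covers infinite variance, where the right-hand side is +oo. This is
    where a != 0 matters, since 0 * +oo is 0. When the variance is finite, y is integrable and may
    be centred. *)
Lemma iid_mean_sqr_le (y : Z -> R) (a b c : R) : measurable_fun setT y -> a != 0 ->
  (\int[P]_w (n%:R^-1 * \sum_i y (zs i w))%:E = c%:E)%E ->
  (\int[P]_w ((a * (n%:R^-1 * \sum_i y (zs i w) - c) - b) ^+ 2)%:E <=
   (a ^+ 2)%:E * ((\int[D]_z ((y z - c) ^+ 2)%:E) * (n%:R^-1)%:E) + (b ^+ 2)%:E)%E.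
Proof.
move=> my a0 mean.
have myc : measurable_fun setT (fun z => y z - c).
  by apply: measurable_funB => //; exact: measurable_cst.
have yc0 z : (0 <= ((y z - c) ^+ 2)%:E)%E by rewrite lee_fin sqr_ge0.
have [sfin|] := ltP (\int[D]_z ((y z - c) ^+ 2)%:E)%E +oo%E; last first.
  rewrite leye_eq => /eqP ->; rewrite gt0_mulye ?lte_fin ?invr_gt0 ?ltr0n//.
  by rewrite gt0_muley ?lte_fin ?exprn_even_gt0// addye ?leey.
have iy2 : D.-integrable setT (fun z => ((y z - c) ^+ 2)%:E).
  apply/integrableP; split; first exact/measurable_EFinP/measurable_funX.
  by under eq_integral => z _ do rewrite gee0_abs//.
have iyc := integrable_sqr_integrable _ _ D _ myc iy2.
have iy : D.-integrable setT (fun z => (y z)%:E).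
  have := integrableD measurableT iyc (finite_measure_integrable_cst D c measurableT).
  by apply: eq_integrable => // z _; rewrite /= -EFinD subrK.
have meanE w : n%:R^-1 * \sum_i y (zs i w) - c = n%:R^-1 * \sum_i (y (zs i w) - c).
  by rewrite big_split/= sumr_const card_ord -[- c *+ n]mulr_natl mulrDr mulKf.
have im : P.-integrable setT (fun w => (n%:R^-1 * \sum_i y (zs i w))%:E).
  have /(integrableZl measurableT n%:R^-1) :
      P.-integrable setT (fun w => (\sum_i (y (zs i w))%:E)%E).
    by apply: integrable_sum => // i _; exact: iid_integrable.
  by apply: eq_integrable => // w _; rewrite sumEFin.
have mean0 : (\int[P]_w (n%:R^-1 * \sum_i (y (zs i w) - c))%:E = 0)%E.
  under eq_integral do rewrite -meanE EFinB.
  rewrite integralB//; last exact: finite_measure_integrable_cst.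
  by rewrite mean integral_cst//= probability_setT mule1 subee.
under eq_integral do rewrite meanE.
by rewrite (iid_centered_mean_sqr (fun z => y z - c)).
Qed.

End iid_mean.

(** * The error of the aggregation rule *)

(* Unlike ge0_le_integral, neither function is assumed measurable: the integral
   of a nonnegative function is a supremum over the simple functions below it. *)
Lemma le_lower_integral (d : measure_display) (T : measurableType d) (R : realType)
    (mu : {measure set T -> \bar R}) (f g : T -> \bar R) :
  (forall x, 0 <= f x)%E -> (forall x, f x <= g x)%E ->
  (\int[mu]_x f x <= \int[mu]_x g x)%E.
Proof.
move=> f0 fg; have g0 x : (0 <= g x)%E by exact: le_trans (f0 x) (fg x).
rewrite !ge0_integralTE//; apply: ge_ereal_sup => _ [h /= hf <-].
by apply: ereal_sup_ubound; exists h => //= x; exact: le_trans (hf x) (fg x).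
Qed.

(** * Mean square of the centred empirical gradient *)

Section target_gradient.
Variables (R : realType) (m : nat) (pi : probability (borelRV R m) R)
  (d : measure_display) (Z : measurableType d) (l : 'rV[R]_m -> Z -> R).
Hypothesis l_meas : measurable_fun [set: borelRV R m * Z] (fun p => l p.1 p.2).
Hypothesis l_diff : forall z theta, differentiable (fun t => l t z) theta.
Hypothesis l_Lpi : forall z, Lpi pi (grad (fun t => l t z)).
Variable DT : probability Z R.
Hypothesis DT_Lpi : Lpi pi (grad (risk l DT)).
Variables (n : nat) (d' : measure_display) (Omega : measurableType d')
  (P : probability Omega R) (zs : 'I_n -> {RV P >-> Z}).
Local Notation LT := (LpiType R m pi).
Local Notation dotL := (dotL R m pi).
Local Notation q u := (dotL u u).

Lemma Lpi_g_hat w : Lpi pi (g_hat l zs w).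
Proof.
have -> : g_hat l zs w = n%:R^-1 *: \sum_i grad (fun t => l t (zs i w)).
  apply/funext => t; apply/rowP => j; rewrite grad_emp_risk//.
  by rewrite fct_sumE !mxE summxE; congr (_ * _).
apply: LpiZ; apply: Lpi_sum => i; exact: l_Lpi.
Qed.

Definition noise w : LT :=
  inLpi R m pi _ (Lpi_g_hat w) - inLpi R m pi _ DT_Lpi.

Lemma noiseE w t j : noise w t 0 j =
  n%:R^-1 * \sum_i grad (fun t => l t (zs i w)) t 0 j - grad (risk l DT) t 0 j.
Proof.
transitivity ((g_hat l zs w t - grad (risk l DT) t) 0 j); first by [].
by rewrite mxE grad_emp_risk// mxE.
Qed.

Lemma measurable_noise j :
  measurable_fun [set: borelRV R m * Omega] (fun p => noise p.2 p.1 0 j).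
Proof.
under eq_fun do rewrite noiseE.
apply: measurable_funB; last first.
  apply: (measurableT_comp (f := fun t : borelRV R m => grad (risk l DT) t 0 j)) => //.
  by case: DT_Lpi.
apply: measurable_funM; first exact: measurable_cst.
apply: measurable_sum => i.
apply: (measurableT_comp (f := fun p : borelRV R m * Z => grad (fun t => l t p.2) p.1 0 j)
  (g := fun p : borelRV R m * Omega => (p.1, zs i p.2))).
  exact: measurable_grad.
by apply: measurable_fun_pair => //; exact: measurableT_comp.
Qed.

Lemma measurable_gap : measurable_fun [set: borelRV R m * Z] (fun p =>
  dotv (grad (fun t => l t p.2) p.1 - grad (risk l DT) p.1)
       (grad (fun t => l t p.2) p.1 - grad (risk l DT) p.1)).
Proof.
have mg j : measurable_fun [set: borelRV R m * Z]
    (fun p => (grad (fun t => l t p.2) p.1 - grad (risk l DT) p.1) 0 j).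
  under eq_fun do rewrite mxE [X in _ + X]mxE.
  apply: measurable_funB; first exact: measurable_grad.
  apply: (measurableT_comp (f := fun t : borelRV R m => grad (risk l DT) t 0 j)) => //.
  by case: DT_Lpi.
by apply: measurable_sum => j; apply: measurable_funM; exact: mg.
Qed.

(** Tonelli puts the integral over z inside, to match estimates made at fixed theta; the sign of the
    difference is reversed as in [noise]. *)
Lemma sigma2E : sigma2 l pi DT =
  (\int[pi]_t \int[DT]_z (dotv (grad (fun t => l t z) t - grad (risk l DT) t)
                            (grad (fun t => l t z) t - grad (risk l DT) t))%:E)%E.
Proof.
rewrite (@fubini_tonelli _ _ _ _ _ pi DT (fun p => (dotv
  (grad (fun t => l t p.2) p.1 - grad (risk l DT) p.1)
  (grad (fun t => l t p.2) p.1 - grad (risk l DT) p.1))%:E))/=.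
- apply: eq_integral => z _; rewrite pi_norm_sqr; apply: eq_integral => t _.
  congr EFin; apply: eq_bigr => j _.
  set u := grad (fun t => l t z) t - _.
  transitivity ((- u) 0 j * (- u) 0 j); first by rewrite opprB.
  by rewrite mxE mulrNN.
- by apply/measurable_EFinP; exact: measurable_gap.
- by move=> p; rewrite lee_fin dotv_ge0.
Qed.

Hypothesis iid_zs : iid DT zs.
Hypothesis n_gt0 : (0 < n)%N.
Hypothesis unbiased : forall theta j,
  (\int[P]_w (g_hat l zs w theta 0 j)%:E = (grad (risk l DT) theta 0 j)%:E)%E.

(** At fixed theta and coordinate j the noise is a centred scalar sample mean, its mean being
    supplied by [unbiased], so [iid_mean_sqr_le] applies with the number b theta 0 j. The integrand
    is a sum of squares, so Tonelli exchanges the integrals without any integrability condition. *)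
Lemma expected_noise_le (L : R) (b : LT) : L != 0 ->
  (\int[P]_w (q (L *: noise w - b))%:E <=
   (L ^+ 2)%:E * (sigma2 l pi DT * (n%:R^-1)%:E) + (q b)%:E)%E.
Proof.
move=> L0; pose k (p : borelRV R m * Omega) j := L * noise p.2 p.1 0 j - b p.1 0 j.
have mk j : measurable_fun [set: borelRV R m * Omega] (k ^~ j).
  apply: measurable_funB.
    by apply: measurable_funM; [exact: measurable_cst|exact: measurable_noise].
  apply: (measurableT_comp (f := fun t : borelRV R m => b t 0 j)) => //.
  by case: (Lpi_mem _ _ _ b).
have -> : (\int[P]_w (q (L *: noise w - b))%:E =
    \int[P]_w \int[pi]_t (\sum_j k (t, w) j ^+ 2)%:E)%E.
  apply: eq_integral => w _; rewrite dotLE; apply: eq_integral => t _.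
  congr EFin; apply: eq_bigr => j _; rewrite -expr2; congr (_ ^+ 2).
  transitivity ((L *: noise w t - b t) 0 j); first by [].
  by rewrite mxE [X in X + _]mxE [X in _ + X]mxE.
have mk2 : measurable_fun [set: borelRV R m * Omega] (fun p => (\sum_j k p j ^+ 2)%:E).
  by apply/measurable_EFinP/measurable_sum => j; exact: measurable_funX.
rewrite -(@fubini_tonelli _ _ _ _ _ pi P (fun p => (\sum_j k p j ^+ 2)%:E))//; last first.
  by move=> p; rewrite lee_fin; apply: sumr_ge0 => j _; exact: sqr_ge0.
pose s t j := (\int[DT]_z ((grad (fun t => l t z) t 0 j - grad (risk l DT) t 0 j) ^+ 2)%:E)%E.
have s_ge0 t j : (0 <= s t j)%E by apply: integral_ge0 => z _; rewrite lee_fin sqr_ge0.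
have mgz j t : measurable_fun setT (fun z => grad (fun t => l t z) t 0 j).
  apply: (measurableT_comp (f := fun p : borelRV R m * Z => grad (fun t => l t p.2) p.1 0 j)
    (g := fun z => (t, z))); first exact: measurable_grad.
  exact: pair1_measurable.
have pointwise t : (\int[P]_w (\sum_j k (t, w) j ^+ 2)%:E <=
    (L ^+ 2)%:E * ((\sum_j s t j) * (n%:R^-1)%:E) + (dotv (b t) (b t))%:E)%E.
  under eq_integral do rewrite -sumEFin.
  rewrite ge0_integral_sum//; last 2 first.
  - move=> j; apply/measurable_EFinP/measurable_funX.
    exact: (measurable_fun_pair2 (f := k ^~ j)).
  - by move=> j w _; rewrite lee_fin sqr_ge0.
  apply: (@le_trans _ _ (\sum_j ((L ^+ 2)%:E * (s t j * (n%:R^-1)%:E) + (b t 0 j ^+ 2)%:E))%E).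
    apply: lee_sum => j _; rewrite /k /=.
    under eq_integral do rewrite noiseE.
    apply: (iid_mean_sqr_le _ _ _ _ _ _ _ _ _ iid_zs n_gt0
      (fun z => grad (fun t => l t z) t 0 j)) => //.
    by rewrite -unbiased; apply: eq_integral => w _; rewrite grad_emp_risk.
  rewrite big_split/= sumEFin -ge0_sume_distrr//; last first.
    by move=> j _; rewrite mule_ge0 ?lee_fin ?invr_ge0.
  by rewrite -ge0_sume_distrl.
pose Y (p : borelRV R m * Z) : R :=
  dotv (grad (fun t => l t p.2) p.1 - grad (risk l DT) p.1)
       (grad (fun t => l t p.2) p.1 - grad (risk l DT) p.1).
have mY : measurable_fun [set: borelRV R m * Z] (fun p => (Y p)%:E).
  by apply/measurable_EFinP; exact: measurable_gap.
have Y0 p : (0 <= (Y p)%:E)%E by rewrite lee_fin dotv_ge0.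
have sE t : (\sum_j s t j = fubini_F DT (fun p => (Y p)%:E) t)%E.
  rewrite -ge0_integral_sum//; last 2 first.
  - move=> j; apply/measurable_EFinP/measurable_funX/measurable_funB => //.
  - by move=> j z _; rewrite lee_fin sqr_ge0.
  apply: eq_integral => z _; rewrite sumEFin; congr EFin.
  apply: eq_bigr => j _; rewrite -[RHS]expr2; congr (_ ^+ 2).
  by rewrite [RHS]mxE; congr (_ + _); rewrite [RHS]mxE.
have mF : measurable_fun setT (fubini_F DT (fun p => (Y p)%:E)).
  exact: measurable_fun_fubini_tonelli_F.
have F0 t : (0 <= fubini_F DT (fun p => (Y p)%:E) t)%E by exact: integral_ge0.
apply: le_trans (le_lower_integral _ _ _ _ _ _ _ pointwise) _.
  by move=> t; apply: integral_ge0 => w _; rewrite lee_fin sumr_ge0// => j _; exact: sqr_ge0.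
under eq_integral do rewrite sE.
have nV : (0 <= n%:R^-1 :> R)%R by rewrite invr_ge0.
rewrite ge0_integralD//; last 4 first.
- by move=> t _; rewrite mule_ge0 ?lee_fin ?sqr_ge0// mule_ge0.
- by apply: measurable_funeM; exact: emeasurable_funM.
- by move=> t _; rewrite lee_fin dotv_ge0.
- by apply/measurable_EFinP; exact: Lpi_measurable (Lpi_mem _ _ _ b) (Lpi_mem _ _ _ b).
rewrite ge0_integralZl//; last 3 first.
- exact: emeasurable_funM.
- by move=> t _; rewrite mule_ge0.
- by rewrite lee_fin sqr_ge0.
by rewrite ge0_integralZr// sigma2E dotLE.
Qed.

End target_gradient.

Section affine_rule.
Variables (R : realType) (m : nat) (pi : probability (borelRV R m) R).
Local Notation LT := (LpiType R m pi).
Local Notation dotL := (dotL R m pi).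
Local Notation q u := (dotL u u).
Local Notation inL := (inLpi R m pi).

(** In use, g, h and k are the empirical, source and target gradients. All identities hold only
    almost everywhere, so both sides are compared through products with z. *)
Lemma affine_error (A G : ('rV[R]_m -> 'rV[R]_m) -> ('rV[R]_m -> 'rV[R]_m))
    (LA : forall g, Lpi pi g -> Lpi pi (A g))
    (LG : forall g, Lpi pi g -> Lpi pi (G g)) (g h k : LT) :
  self_adjoint pi G -> linear_part pi A G -> A h = h %[ae pi] ->
  (pi_norm pi ((k : 'rV[R]_m -> 'rV[R]_m) - A g) ^+ 2 =
   (q ((k - h) - Lpi_op R m pi G LG (k - h) - Lpi_op R m pi G LG (g - k)))%:E)%E.
Proof.
move=> saG [_ AG] Ah.
have E := dotE R _ dotL (dotLC R m pi) (dotL_lin R m pi).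
pose T := Lpi_op R m pi G LG; pose A' u := inL _ (LA _ (Lpi_mem R m pi u)).
have wA z : dotL (A' g) z = dotL h z + dotL (T (g - h)) z.
  have h1 : dotL (A' g - A' h) z = dotL (T (g - h)) z.
    by apply: ae_eq_dotL; exact: AG (Lpi_mem _ _ _ g) (Lpi_mem _ _ _ h).
  have h2 : dotL (A' h) z = dotL h z by apply: ae_eq_dotL.
  by move: h1; rewrite !E h2 => <-; lra.
transitivity (pi_norm pi (k - A' g) ^+ 2)%E; first by [].
rewrite pi_norm_sqrL; congr EFin; apply: q_weak_eq (dotLC R m pi) _ _ _ => z.
have wT : dotL (T (g - h)) z = dotL (T (g - k)) z + dotL (T (k - h)) z.
  have -> : g - h = 1 *: (g - k) + (k - h) by rewrite scale1r addrA subrK.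
  rewrite (symmetric_lin _ _ _ (dotL_lin R m pi) T) ?mul1r//.
  exact: symmetric_Lpi_op.
by rewrite !E -/T wA wT; ring.
Qed.

End affine_rule.

(** * Mean squared error of an affine image of a random element *)

Section random_elements.
Variables (R : realType) (m : nat) (pi : probability (borelRV R m) R)
  (d : measure_display) (Omega : measurableType d) (P : probability Omega R).
Local Notation LT := (LpiType R m pi).
Local Notation dotL := (dotL R m pi).
Local Notation q u := (dotL u u).
Local Notation dotL_simp := (dotE R _ dotL (dotLC R m pi) (dotL_lin R m pi)).

Variable x : Omega -> LT.
Hypothesis smeas_x : strongly_measurable R LT dotL d Omega x.

Lemma measurable_sqnorm (y : Omega -> LT) : strongly_measurable R LT dotL d Omega y ->
  measurable_fun setT (fun w => q (y w)).
Proof.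
move=> my; apply: (measurable_bounded_form R LT dotL (dotL_ge0 R m pi) d Omega dotL) => //.
- exact: dotLC.
- exact: dotL_lin.
- move=> z; exists (q z + 1) => u.
  exact: dot_sqr_le (dotLC R m pi) (dotL_lin R m pi) (dotL_ge0 R m pi) u z.
Qed.

Variables (T : LT -> LT) (L : R).
Hypothesis symT : symmetric_op R LT dotL T.
Hypothesis T_le : forall u, q (T u) <= L ^+ 2 * q u.

Lemma sqnorm_affine a u :
  q (a - T u) = q a - 2 * dotL (T a) u + dotL (T u) (T u).
Proof. by rewrite (symT a u) !dotL_simp (dotLC _ _ _ (T u) a); ring. Qed.

(** T respects sums and multiples only weakly, so strong measurability is not transferred to T x.
    The expansion instead involves <T a, u> and <T u, T v>, which are exactly bilinear and
    bounded. *)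
Lemma measurable_sqnorm_affine a : measurable_fun setT (fun w => q (a - T (x w))).
Proof.
under eq_fun do rewrite sqnorm_affine.
have Tlin := symmetric_lin _ _ _ (dotL_lin R m pi) T symT.
have CS := dot_sqr_le _ _ _ (dotLC R m pi) (dotL_lin R m pi) (dotL_ge0 R m pi).
apply: measurable_funD.
  apply: measurable_funB; first exact: measurable_cst.
  apply: measurable_funM; first exact: measurable_cst.
  apply: (measurable_bounded_form R LT dotL (dotL_ge0 R m pi) d Omega dotL) => //.
  - exact: dotLC.
  - exact: dotL_lin.
  - by move=> z; exists (q z + 1) => u; exact: CS.
  - exact: smeas_cst.
apply: (measurable_bounded_form R LT dotL (dotL_ge0 R m pi) d Omega
  (fun u v => dotL (T u) (T v))) => //.
- by move=> u v; exact: dotLC.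
- move=> z; exists ((q (T z) + 1) * L ^+ 2) => u.
  apply: le_trans (CS _ _) _; rewrite -mulrA ler_wpM2l//.
  by rewrite addr_ge0 ?dotL_ge0.
Qed.

Lemma integral_sqnorm_affine_le (S : \bar R) (a : LT) : (0 <= S)%E ->
  (forall b : LT, L != 0 -> (\int[P]_w (q (L *: x w - b))%:E <=
    (L ^+ 2)%:E * S + (q b)%:E)%E) ->
  (\int[P]_w (q (a - T (x w)))%:E <= (L ^+ 2)%:E * S + (q a)%:E)%E.
Proof.
(* For L = 0 the elements T (x w) have norm zero and the integrand is the constant q a; the element
   b used otherwise would divide by zero. *)
move=> S0 hx; have [L0|L0] := eqVneq L 0.
  have -> : (\int[P]_w (q (a - T (x w)))%:E = \int[P]_w (q a)%:E)%E.
    apply: eq_integral => w _; congr EFin.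
    have qT : q (T (x w)) = 0.
      apply/eqP; rewrite eq_le dotL_ge0 andbT.
      by have := T_le (x w); rewrite L0 expr0n mul0r.
    have := dot_sqr_le _ _ _ (dotLC R m pi) (dotL_lin R m pi) (dotL_ge0 R m pi) (T (x w)) a.
    rewrite qT mulr0 => h.
    have /eqP : dotL (T (x w)) a ^+ 2 == 0 by rewrite eq_le h sqr_ge0.
    move/eqP; rewrite sqrf_eq0 => /eqP cross.
    by rewrite !dotL_simp (dotLC _ _ _ a) cross qT; ring.
  by rewrite integral_cst//= probability_setT mule1 L0 expr0n mul0e add0e.
(* Completing the square leaves the integrand |L x - b|^2, nonnegative before
   integrating over theta, so that Tonelli suffices. *)
pose b := L^-1 *: T a; pose C := q a - q b.
have qb : q b = L ^- 2 * q (T a) by rewrite /b !dotL_simp; field.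
(* C is what completing the square leaves over; its sign, which follows from |T a|^2 <= L^2 |a|^2,
   allows the integral to be split. *)
have C0 : 0 <= C.
  by rewrite subr_ge0 qb ler_pdivrMl ?exprn_even_gt0//; exact: T_le.
have mLx : strongly_measurable R LT dotL d Omega (fun w => L *: x w - b).
  apply: smeas_add; last exact: smeas_cst.
  by apply: smeas_scale => //; [exact: dotLC|exact: dotL_lin].
apply: (@le_trans _ _ (\int[P]_w ((q (L *: x w - b))%:E + C%:E))%E).
  apply: le_lower_integral => w; first by rewrite lee_fin dotL_ge0.
  rewrite -EFinD lee_fin sqnorm_affine.
  have -> : q (L *: x w - b) = L ^+ 2 * q (x w) - 2 * dotL (T a) (x w) + q b.
    by rewrite /b !dotL_simp (dotLC _ _ _ (x w)); field.
  by have := T_le (x w); rewrite /C; lra.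
rewrite ge0_integralD//; last 2 first.
- by move=> w _; rewrite lee_fin dotL_ge0.
- by apply/measurable_EFinP; exact: measurable_sqnorm.
rewrite integral_cst//= probability_setT mule1.
apply: le_trans (leeD2r _ (hx b L0)) _.
by rewrite -addeA -EFinD /C (addrC (q b)) subrK.
Qed.

End random_elements.

Lemma pi_norm_mean_le (R : realType) (m : nat) (pi : probability (borelRV R m) R)
    (N : nat) (g : 'rV[R]_m -> 'rV[R]_m) (f : 'I_N -> 'rV[R]_m -> 'rV[R]_m) :
  (0 < N)%N -> Lpi pi g -> (forall i, Lpi pi (f i)) ->
  (pi_norm pi (g - N%:R^-1 *: \sum_i f i) ^+ 2 <=
   (N%:R^-1)%:E * \sum_i pi_norm pi (g - f i) ^+ 2)%E.
Proof.
move=> N0 Lg Lf; have NR : N%:R != 0 :> R by rewrite pnatr_eq0 -lt0n.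
pose e i : LpiType R m pi := inLpi _ _ _ _ Lg - inLpi _ _ _ _ (Lf i).
have -> : g - N%:R^-1 *: \sum_i f i = Lpi_fun _ _ _ (N%:R^-1 *: \sum_i e i).
  transitivity (N%:R^-1 *: \sum_i (g - f i)).
    by rewrite sumrB sumr_const card_ord scalerBr -[g *+ N]scaler_nat scalerA mulVf// scale1r.
  transitivity (N%:R^-1 *: Lpi_fun _ _ _ (\sum_i e i)); last by [].
  by congr (_ *: _); elim/big_ind2 : _ => // ? ? ? ? -> ->.
rewrite pi_norm_sqrL.
rewrite (eq_bigr (fun i => (dotL R m pi (e i) (e i))%:E)); last first.
  by move=> i _; rewrite -pi_norm_sqrL.
rewrite sumEFin -EFinM lee_fin.
exact: q_mean_le (dotLC R m pi) (dotL_lin R m pi) (dotL_ge0 R m pi) _ _ N0.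
Qed.

Theorem theorem3p6
  (R : realType) (m : nat) (pi : probability (borelRV R m) R)
  (* the aggregation rule *)
  (F : ('rV[R]_m -> 'rV[R]_m) -> ('rV[R]_m -> 'rV[R]_m) ->
       ('rV[R]_m -> 'rV[R]_m))
  (lmin lmax : R) (hl : lmin <= lmax)
  (hF : forall g g', Lpi pi g -> Lpi pi g' -> Lpi pi (F g g'))
  (hF_affine : forall g', Lpi pi g' -> affine_Lpi pi (fun g => F g g'))
  (hF_diag : forall g, Lpi pi g -> F g g = g %[ae pi])
  (hF_sa : forall g' G, Lpi pi g' -> linear_part pi (fun g => F g g') G ->
     self_adjoint pi G)
  (hF_spec : forall g' G, Lpi pi g' -> linear_part pi (fun g => F g g') G ->
     forall lam, spectrum pi G lam -> lmin <= lam <= lmax)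
  (* the loss *)
  (d : measure_display) (Z : measurableType d) (l : 'rV[R]_m -> Z -> R)
  (hl_ge0 : forall theta z, 0 <= l theta z)
  (hl_meas : measurable_fun [set: borelRV R m * Z] (fun p => l p.1 p.2))
  (hl_diff : forall z theta, differentiable (fun t => l t z) theta)
  (hl_Lpi : forall z, Lpi pi (grad (fun t => l t z)))
  (* the source and target domains *)
  (N : nat) (hN : (0 < N)%N) (DS : 'I_N -> probability Z R)
  (DT : probability Z R)
  (hDS : forall i, admissible l pi (DS i)) (hDT : admissible l pi DT)
  (* the target dataset *)
  (n : nat) (hn : (0 < n)%N) (d' : measure_display) (Omega : measurableType d')
  (P : probability Omega R) (zs : 'I_n -> {RV P >-> Z}) (hzs : iid DT zs)
  (hE : forall theta j,
     (\int[P]_w (g_hat l zs w theta 0 j)%:E = (grad (risk l DT) theta 0 j)%:E)%E) :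
  (delta2_aggr pi l F zs DT DS
     <= (N%:R^-1)%:E * \sum_(i < N) delta2_source pi l F zs DT (DS i))%E
  /\
  (forall i : 'I_N,
     delta2_source pi l F zs DT (DS i)
       <= (Num.max (lmax ^+ 2) (lmin ^+ 2))%:E * (sigma2 l pi DT * (n%:R^-1)%:E)
          + (Num.max ((1 - lmax) ^+ 2) ((1 - lmin) ^+ 2))%:E
            * (pi_dist l pi (DS i) DT) ^+ 2)%E.
Proof.
have LgT : Lpi pi (grad (risk l DT)) by case: hDT.
have LgS i : Lpi pi (grad (risk l (DS i))) by case: (hDS i).
have Lhat := Lpi_g_hat R m pi d Z l hl_diff hl_Lpi n d' Omega P zs.
pose x := noise R m pi d Z l hl_diff hl_Lpi DT LgT n d' Omega P zs.
have smx : strongly_measurable R _ (dotL R m pi) d' Omega x.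
  apply: strongly_measurable_kernel => j.
  exact: (measurable_noise R m pi d Z l hl_meas hl_diff hl_Lpi DT LgT n d' Omega P zs j).
have /choice[G hG] : forall i, exists G,
    linear_part pi (fun g => F g (grad (risk l (DS i)))) G.
  by move=> i; exact: (hF_affine _ (LgS i)).2.
pose T i := Lpi_op R m pi (G i) (hG i).1.1.
have saG i := hF_sa _ _ (LgS i) (hG i).
have spG i := hF_spec _ _ (LgS i) (hG i).
have symT i : symmetric_op R _ (dotL R m pi) (T i) by exact: symmetric_Lpi_op.
pose gT := inLpi R m pi _ LgT; pose u i := gT - inLpi R m pi _ (LgS i).
pose a i := u i - T i (u i).
pose q (v : LpiType R m pi) := dotL R m pi v v.
(* Completing the square calls for the scalar L itself; its square is the maximum in the
   statement. *)
pose L := Num.max `|lmax| `|lmin|.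
have T_le i v : q (T i v) <= L ^+ 2 * q v.
  by rewrite /L sqr_max_norm; exact: (Lpi_op_norm_le R m pi _ (hG i).1.1 (saG i) _ _ (spG i)).
have errE i w : (pi_norm pi (grad (risk l DT) -
    F (g_hat l zs w) (grad (risk l (DS i)))) ^+ 2 = (q (a i - T i (x w)))%:E)%E.
  have LA g (Lg : Lpi pi g) := hF _ _ Lg (LgS i).
  have Ah := hF_diag _ (LgS i).
  exact: (affine_error R m pi (fun g => F g (grad (risk l (DS i)))) (G i) LA
    (hG i).1.1 (inLpi R m pi _ (Lhat w)) (inLpi R m pi _ (LgS i)) gT (saG i) (hG i) Ah).
have sourceE i : (delta2_source pi l F zs DT (DS i) =
    \int[P]_w (q (a i - T i (x w)))%:E)%E.
  by apply: eq_integral => w _; exact: errE.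
have q_ge0 v : 0 <= q v by exact: dotL_ge0.
(* Interchanging the sum over the sources with the expectation requires each squared error to be
   measurable. *)
have mq i : measurable_fun setT (fun w => (q (a i - T i (x w)))%:E).
  apply/measurable_EFinP.
  exact: (measurable_sqnorm_affine _ _ _ _ _ _ smx _ L (symT i) (T_le i)).
have NR : 0 <= N%:R^-1 :> R by rewrite invr_ge0.
split=> [|i].
  under eq_bigr do rewrite sourceE.
  rewrite -ge0_integral_sum//; last by move=> i w _; rewrite lee_fin.
  rewrite -ge0_integralZl//; last 2 first.
  - exact: emeasurable_sum.
  - by move=> w _; apply: sume_ge0 => i _; rewrite lee_fin.
  apply: le_lower_integral => w; first by rewrite pi_norm_sqr pi_dot_ge0.
  apply: le_trans (pi_norm_mean_le _ _ _ _ _ _ hN LgT _) _.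
    by move=> i; exact: hF _ _ (Lhat w) (LgS i).
  by under eq_bigr do rewrite errE.
have sigma_ge0 : (0 <= sigma2 l pi DT * (n%:R^-1)%:E)%E.
  rewrite mule_ge0 ?lee_fin ?invr_ge0//; apply: integral_ge0 => z _.
  by rewrite pi_norm_sqr pi_dot_ge0.
rewrite sourceE; apply: le_trans.
  apply: (integral_sqnorm_affine_le _ _ _ _ _ P _ smx _ L (symT i) (T_le i) _ (a i) sigma_ge0).
  move=> b; exact: (expected_noise_le R m pi d Z l hl_meas hl_diff hl_Lpi DT LgT
    n d' Omega P zs hzs hn hE L b).
rewrite /L sqr_max_norm leeD2l//.
have -> : (pi_dist l pi (DS i) DT ^+ 2 = (q (u i))%:E)%E by rewrite -pi_norm_sqrL.
by rewrite -EFinM lee_fin; exact: (Lpi_op_compl_norm_le R m pi _ (hG i).1.1 (saG i) _ _ (spG i)).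
Qed.
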